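(* Let $\phi:\mathbb{R}\to\mathbb{C}$ be defined by $\phi(t)=\sum_{k\in\mathbb{Z}}\frac{e^{-4\pi^2 i k^2 t}-1}{-4\pi^2k^2}$, where the term $k=0$ is understood as its limiting value $it$. For $\sigma\ge 0$ let $D_\sigma=\{x\in\mathbb{R} : \alpha_\phi(x)=\sigma\}$. Then for every $\alpha\in[1/2,3/4]$, \[\dim_{\mathcal H}\phi(D_\alpha)\le \dim_{\mathcal H}\phi\Big(\bigcup_{\sigma\le\alpha}D_\sigma\Big)\le \frac{4\alpha-2}{\alpha}.\]
   Context: For $\beta\ge0$ and $x_0\in\mathbb{R}$, a function $f:\mathbb{R}\to\mathbb{C}$ is in $C^\beta(x_0)$ if there exist a polynomial $P$ (complex coefficients) with $\deg P\le\beta$ and a constant $C>0$ such that $|f(x_0+h)-P(h)|\le C|h|^\beta$ for all sufficiently small $|h|$. The Hölder exponent of $f$ at $x_0$ is $\alpha_f(x_0)=\sup\{\beta\ge0 : f\in C^\beta(x_0)\}$. $\dim_{\mathcal H}$ denotes Hausdorff dimension in $\mathbb{C}\cong\mathbb{R}^2$. *)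

(* Defs.v *)
From Stdlib Require Import Reals ZArith.
From Coquelicot Require Import Coquelicot.
Open Scope R_scope.

(* k-th term, k <> 0:  (e^{-4 pi^2 i k^2 t} - 1) / (-4 pi^2 k^2),
   written with e^{-i th} = cos th - i sin th, th = 4 pi^2 k^2 t. *)
Definition phi_term (k : Z) (t : R) : C :=
  let a := 4 * PI ^ 2 * (IZR k) ^ 2 in
  RtoC (/ (- a)) * (Cminus (cos (a * t), - sin (a * t)) (RtoC 1)).

(* sum over k in Z, the k = 0 term being its limiting value i t;
   the sum over Z \ {0} is taken as the (absolutely convergent) series
   over n >= 1 of the terms k = n and k = -n, componentwise. *)
Definition phi_pair (n : nat) (t : R) : C :=
  Cplus (phi_term (Z.of_nat (S n)) t) (phi_term (- Z.of_nat (S n))%Z t).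

Definition phi (t : R) : C :=
  Cplus (0, t) (Series (fun n => fst (phi_pair n t)),
                Series (fun n => snd (phi_pair n t))).

(* x^b for x >= 0 and b >= 0, with 0^0 = 1 and 0^b = 0 for b > 0 *)
Definition rpow (x b : R) : R :=
  if Rlt_dec 0 x then Rpower x b
  else if Req_EM_T b 0 then 1 else 0.

Fixpoint cpoly (c : nat -> C) (n : nat) (h : R) : C :=
  match n with
  | O => c O
  | S m => Cplus (cpoly c m h) (Cmult (c (S m)) (RtoC (h ^ S m)))
  end.

Definition holder_at (f : R -> C) (x0 beta : R) : Prop :=
  exists (n : nat) (c : nat -> C) (K delta : R),
    INR n <= beta /\ 0 < K /\ 0 < delta /\
    forall h : R, Rabs h < delta ->
      Cmod (Cminus (f (x0 + h)) (cpoly c n h)) <= K * rpow (Rabs h) beta.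

Definition holder_exponent (f : R -> C) (x0 : R) : Rbar :=
  Lub_Rbar (fun beta => 0 <= beta /\ holder_at f x0 beta).

(* diameter of a set (0 for the empty set; meaningful for bounded sets) *)
Definition diam (U : C -> Prop) : R :=
  real (Lub_Rbar (fun r => r = 0 \/ exists x y, U x /\ U y /\ r = Cmod (Cminus x y))).

Definition bounded_by (U : C -> Prop) (delta : R) : Prop :=
  forall x y, U x -> U y -> Cmod (Cminus x y) <= delta.

Definition diam_pow (U : C -> Prop) (s : R) : R :=
  if Rlt_dec 0 (diam U) then Rpower (diam U) s else 0.

Definition hausdorff_pre (s delta : R) (A : C -> Prop) : Rbar :=
  Glb_Rbar (fun r => exists U : nat -> (C -> Prop),
    (forall i, bounded_by (U i) delta) /\
    (forall z, A z -> exists i, U i z) /\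
    is_series (fun i => diam_pow (U i) s) r).

(* H^s(A) = lim_{delta -> 0} H^s_delta(A) = sup over delta = 1/(n+1) *)
Definition hausdorff_measure (s : R) (A : C -> Prop) : Rbar :=
  Sup_seq (fun n => hausdorff_pre s (/ INR (S n)) A).

Definition hausdorff_dim (A : C -> Prop) : Rbar :=
  Glb_Rbar (fun s => 0 < s /\ hausdorff_measure s A = Finite 0).

Definition image (f : R -> C) (D : R -> Prop) : C -> Prop :=
  fun z => exists x, D x /\ f x = z.

Definition D_level (sigma : R) : R -> Prop :=
  fun x => holder_exponent phi x = Finite sigma.

Definition D_below (alpha : R) : R -> Prop :=
  fun x => exists sigma, 0 <= sigma /\ sigma <= alpha /\ D_level sigma x.

(* Main.v *)
Require Import Defs.
From Stdlib Require Import Reals ZArith Lra Lia List Arith Cantor.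
From Stdlib Require Import Classical IndefiniteDescription.
From Coquelicot Require Import Coquelicot.
Open Scope R_scope.

(* Put [y = 2 PI t], so that [phi] is, up to a linear term, a multiple of the sum over [k >= 1] of
   [(e^(-2 PI i k^2 y) - 1) / k^2].  Everything follows from Weyl's inequality for the
   quadratic sums [S_n(y)], the sum of [e^(2 PI i k^2 y)] over [1 <= k <= n]: if [p / q] is reduced
   and [|y - p / q| <= 1 / q^2], then [|S_n(y)|^2 << q^e (n^2 / q + n + q)].  An increment of [phi]
   over [[y, y + h]] is controlled by the [S_n(x)] with [n >= |h|^(-1/2)] and [x] in that interval:
   use the mean value theorem on the frequencies [k <= |h|^(-1/2)] and summation by parts on
   the others.  This has two consequences.

   - Around a reduced [p / q], and for [|h| <= 1 / q^2], the increment is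
     [<< q^(-1/2) |h|^(1/2 - e/2)].
   - If [|y - p / q| >= c q^(-mu)] for all reduced [p / q], with [mu >= 2], then Dirichlet's theorem
     provides good denominators at every scale and the increments at [y] are
     [<< |h|^(1/2 + 1/(2 mu) - e/2)].

   By the second one, a point with Holder exponent [<= alpha < 1/2 + 1/(2 mu)] is rational or lies
   within [q^(-mu)] of infinitely many reduced [p / q] (for [alpha = 3/4] Dirichlet's theorem gives
   this with [mu = 2]).  By the first one the images of those neighbourhoods have diameter
   [<< q^(-(1 + mu)/2 + mu e/2)]; as there are about [q] of them per unit interval, the
   Hausdorff measure of exponent [s] vanishes as soon as [s (1 + mu) > 4], and [4 / (1 + mu)]
   tends to [(4 alpha - 2) / alpha] when [mu] tends to [1 / (2 alpha - 1)]. *)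

(** * Finite sums *)

Fixpoint rsum (f : nat -> R) (n : nat) : R :=
  match n with O => 0 | S m => rsum f m + f m end.

Definition lsum {T : Type} (f : T -> R) (l : list T) : R :=
  fold_right (fun x s => f x + s) 0 l.

Lemma rsum_S (f : nat -> R) (n : nat) : rsum f (S n) = rsum f n + f n.
Proof. reflexivity. Qed.

Lemma rsum_ext (f g : nat -> R) (n : nat) :
  (forall k, (k < n)%nat -> f k = g k) -> rsum f n = rsum g n.
Proof.
  induction n as [|n IH]; intros H; simpl; [reflexivity|].
  rewrite IH, H; auto with arith.
Qed.

Lemma rsum_le (f g : nat -> R) (n : nat) :
  (forall k, (k < n)%nat -> f k <= g k) -> rsum f n <= rsum g n.
Proof.
  induction n as [|n IH]; intros H; simpl; [lra|].
  apply Rplus_le_compat; auto with arith.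
Qed.

Lemma rsum_plus (f g : nat -> R) (n : nat) :
  rsum (fun k => f k + g k) n = rsum f n + rsum g n.
Proof. induction n as [|n IH]; simpl; [ring | rewrite IH; ring]. Qed.

Lemma rsum_scal (c : R) (f : nat -> R) (n : nat) :
  rsum (fun k => c * f k) n = c * rsum f n.
Proof. induction n as [|n IH]; simpl; [ring | rewrite IH; ring]. Qed.

Lemma rsum_const (c : R) (n : nat) : rsum (fun _ => c) n = INR n * c.
Proof. induction n as [|n IH]; [simpl; ring | rewrite S_INR; simpl; rewrite IH; ring]. Qed.

Lemma rsum_nonneg (f : nat -> R) (n : nat) :
  (forall k, 0 <= f k) -> 0 <= rsum f n.
Proof. intros H; induction n as [|n IH]; simpl; [lra|]. specialize (H n); lra. Qed.

Lemma rsum_monotone (f : nat -> R) (n m : nat) :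
  (forall k, 0 <= f k) -> (n <= m)%nat -> rsum f n <= rsum f m.
Proof. intros H; induction 1; simpl; [lra|]. specialize (H m); lra. Qed.

Lemma rsum_abs (f : nat -> R) (n : nat) :
  Rabs (rsum f n) <= rsum (fun k => Rabs (f k)) n.
Proof.
  induction n as [|n IH]; simpl; [rewrite Rabs_R0; lra|].
  eapply Rle_trans; [apply Rabs_triang|]; lra.
Qed.

Lemma rsum_add (f : nat -> R) (n m : nat) :
  rsum f (n + m) = rsum f n + rsum (fun k => f (n + k)%nat) m.
Proof.
  induction m as [|m IH]; [rewrite Nat.add_0_r; simpl; ring|].
  rewrite Nat.add_succ_r; simpl; rewrite IH; ring.
Qed.

Lemma rsum_rev (f : nat -> R) (n : nat) :
  rsum f n = rsum (fun k => f (n - 1 - k)%nat) n.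
Proof.
  induction n as [|n IH]; [reflexivity|].
  change (S n) with (1 + n)%nat at 3; rewrite rsum_add; simpl.
  rewrite IH, !Nat.sub_0_r, Rplus_0_l, Rplus_comm; f_equal.
  apply rsum_ext; intros k Hk; f_equal; lia.
Qed.

Lemma rsum_lsum (f : nat -> R) (n : nat) : rsum f n = lsum f (seq 0 n).
Proof.
  assert (app : forall l1 l2, lsum f (l1 ++ l2) = lsum f l1 + lsum f l2).
  { induction l1 as [|a l IH]; intros l2; simpl; [ring|]. rewrite IH; ring. }
  induction n as [|n IH]; [reflexivity|].
  rewrite seq_S, app, <- IH; simpl; ring.
Qed.

Lemma lsum_map {S T : Type} (f : T -> R) (g : S -> T) (l : list S) :
  lsum f (map g l) = lsum (fun x => f (g x)) l.
Proof. induction l as [|a l IH]; simpl; [|rewrite IH]; reflexivity. Qed.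

Lemma lsum_ge0 {T : Type} (f : T -> R) (l : list T) :
  (forall x, 0 <= f x) -> 0 <= lsum f l.
Proof. intros H; induction l as [|a l IH]; simpl; [lra|]. specialize (H a); lra. Qed.

Lemma lsum_incl {T : Type} (f : T -> R) (l l' : list T) :
  (forall x, 0 <= f x) -> NoDup l -> incl l l' -> lsum f l <= lsum f l'.
Proof.
  intros Hf; revert l'; induction l as [|a l IH]; intros l' Hnd Hin.
  { apply lsum_ge0; exact Hf. }
  inversion Hnd as [|? ? Ha Hl]; subst.
  destruct (in_split a l' (Hin a (or_introl eq_refl))) as (l1 & l2 & ->).
  assert (E : lsum f (l1 ++ a :: l2) = f a + lsum f (l1 ++ l2)).
  { clear; induction l1 as [|b l1 IH]; simpl; [ring|]. rewrite IH; ring. }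
  rewrite E; simpl; apply Rplus_le_compat_l, IH; [exact Hl|].
  intros x Hx. specialize (Hin x (or_intror Hx)).
  apply in_app_or in Hin; apply in_or_app; simpl in Hin.
  destruct Hin as [H|[H|H]]; auto. subst; contradiction.
Qed.

Lemma rsum_reindex (f : nat -> R) (g : nat -> nat) (n m : nat) :
  (forall k, 0 <= f k) ->
  (forall k, (k < n)%nat -> (g k < m)%nat) ->
  (forall j k, (j < n)%nat -> (k < n)%nat -> g j = g k -> j = k) ->
  rsum (fun k => f (g k)) n <= rsum f m.
Proof.
  intros Hf Hlt Hinj. rewrite !rsum_lsum, <- (lsum_map f g).
  apply lsum_incl; [exact Hf| |].
  - apply NoDup_map_NoDup_ForallPairs; [|apply seq_NoDup].
    intros j k Hj Hk; apply in_seq in Hj, Hk; apply Hinj; lia.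
  - intros x Hx; apply in_map_iff in Hx; destruct Hx as (k & <- & Hk).
    apply in_seq in Hk; apply in_seq; split; [lia|]. simpl; apply Hlt; lia.
Qed.

Lemma sum_n_rsum (f : nat -> R) (n : nat) : sum_n f n = rsum f (S n).
Proof.
  induction n as [|n IH]; [rewrite sum_O; simpl; ring|].
  rewrite sum_Sn, IH; reflexivity.
Qed.

(** Any initial stretch of the Cantor enumeration lies in a finite square, and the square can be
    summed row by row. This turns doubly indexed covers into sequences. *)
Lemma double_sum_bound (f : nat -> nat -> R) (g : nat -> R) (E : R) :
  (forall i j, 0 <= f i j) ->
  (forall i n, rsum (f i) n <= g i) ->
  (forall n, rsum g n <= E) ->
  forall n, rsum (fun k => f (fst (Cantor.of_nat k)) (snd (Cantor.of_nat k))) n <= E.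
Proof.
  intros Hf Hg HE n.
  rewrite rsum_lsum, <- (lsum_map (fun ij => f (fst ij) (snd ij)) Cantor.of_nat).
  set (l := map Cantor.of_nat (seq 0 n)).
  assert (Hm : exists m, incl l (list_prod (seq 0 m) (seq 0 m))).
  { exists n. intros [i j] Hx; apply in_map_iff in Hx; destruct Hx as (k & Hk & Hin).
    apply in_seq in Hin.
    assert (Hk' : k = Cantor.to_nat (i, j)) by (rewrite <- Hk, Cantor.cancel_to_of; auto).
    pose proof (Cantor.to_nat_non_decreasing i j).
    apply in_prod; apply in_seq; lia. }
  destruct Hm as [m Hm].
  eapply Rle_trans; [apply (lsum_incl _ l (list_prod (seq 0 m) (seq 0 m)))|].
  - intros [i j]; apply Hf.
  - apply NoDup_map_NoDup_ForallPairs; [|apply seq_NoDup].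
    intros a b _ _ Hab. rewrite <- (Cantor.cancel_to_of a), Hab; apply Cantor.cancel_to_of.
  - exact Hm.
  - eapply Rle_trans; [|apply (HE m)].
    assert (H : forall l1 : list nat, lsum (fun ij => f (fst ij) (snd ij)) (list_prod l1 (seq 0 m))
                <= lsum g l1).
    { induction l1 as [|a l1 IH]; simpl; [lra|].
      assert (app : forall l1 l2 : list (nat * nat), lsum (fun ij => f (fst ij) (snd ij)) (l1 ++ l2)
          = lsum (fun ij => f (fst ij) (snd ij)) l1 + lsum (fun ij => f (fst ij) (snd ij)) l2).
      { clear; induction l1 as [|b l IH]; intros l2; simpl; [ring|]. rewrite IH; ring. }
      rewrite app; apply Rplus_le_compat; [|exact IH].
      rewrite lsum_map; simpl. rewrite <- (rsum_lsum (fun x => f a x)); apply Hg. }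
    rewrite rsum_lsum; apply H.
Qed.

(** * Dirichlet's approximation theorem *)

(* Consecutive Farey fractions enclose [y]; [b c - a d = 1] gives coprimality for free. *)
Lemma farey_neighbours (y : R) (n : nat) : (1 <= n)%nat ->
  exists a b c d : Z, (0 < b <= Z.of_nat n)%Z /\ (0 < d <= Z.of_nat n)%Z /\
    (Z.of_nat n < b + d)%Z /\ (b * c - a * d = 1)%Z /\
    IZR a <= y * IZR b /\ y * IZR d <= IZR c.
Proof.
  intros Hn; induction Hn as [|n Hn IH].
  - exists (Int_part y), 1%Z, (Int_part y + 1)%Z, 1%Z.
    destruct (base_Int_part y) as [H1 H2].
    rewrite plus_IZR. repeat split; try lia; lra.
  - destruct IH as (a & b & c & d & Hb & Hd & Hbd & E & H1 & H2).
    destruct (Z_lt_le_dec (Z.of_nat (S n)) (b + d)) as [H|H].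
    { exists a, b, c, d; repeat split; try lia; assumption. }
    (* Here [b + d] is exactly [n + 1]: the mediant enters and replaces the neighbour on its own
       side of [y]. *)
    destruct (Rle_lt_dec (IZR (a + c)) (y * IZR (b + d))) as [H3|H3].
    + exists (a + c)%Z, (b + d)%Z, c, d; repeat split; try lia; assumption.
    + exists a, b, (a + c)%Z, (b + d)%Z; repeat split; try lia; lra.
Qed.

(** Take the Farey neighbours of order [n], the floor of [X], and keep the one on the same side of
    the mediant as [y]. Its distance to the mediant is [1 / (b (b + d))] or [1 / (d (b + d))], and
    [b + d >= n + 1 > X]. *)
Lemma dirichlet (y X : R) : 1 <= X ->
  exists p q : Z, (0 < q)%Z /\ Z.gcd p q = 1%Z /\ IZR q <= X /\
    Rabs (y - IZR p / IZR q) <= / (IZR q * X).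
Proof.
  intros HX.
  destruct (nfloor_ex X ltac:(lra)) as [n [Hn1 Hn2]].
  assert (Hn : (1 <= n)%nat).
  { destruct n; [simpl in Hn2; lra | lia]. }
  destruct (farey_neighbours y n Hn) as (a & b & c & d & Hb & Hd & Hbd & E & H1 & H2).
  assert (HX' : X <= IZR b + IZR d).
  { apply Rle_trans with (INR n + 1); [lra|].
    rewrite INR_IZR_INZ, <- !plus_IZR; apply IZR_le; lia. }
  assert (HER : IZR b * IZR c - IZR a * IZR d = 1).
  { rewrite <- !mult_IZR, <- minus_IZR; now rewrite E. }
  assert (Hb0 : 0 < IZR b) by (apply IZR_lt; lia).
  assert (Hd0 : 0 < IZR d) by (apply IZR_lt; lia).
  assert (HbX : IZR b <= X).
  { apply Rle_trans with (INR n); [|lra]. rewrite INR_IZR_INZ; apply IZR_le; lia. }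
  assert (HdX : IZR d <= X).
  { apply Rle_trans with (INR n); [|lra]. rewrite INR_IZR_INZ; apply IZR_le; lia. }
  destruct (Rle_lt_dec (y * (IZR b + IZR d)) (IZR a + IZR c)) as [H3|H3].
  - exists a, b; repeat split; try lia; try assumption.
    + apply Z.bezout_1_gcd. exists (-d)%Z, c. lia.
    + replace (y - IZR a / IZR b) with ((y * IZR b - IZR a) / IZR b) by (field; lra).
      unfold Rdiv; rewrite Rabs_mult, (Rabs_pos_eq (/ _)), Rinv_mult, Rmult_comm
        by (left; apply Rinv_0_lt_compat; lra).
      apply Rmult_le_compat_l; [left; apply Rinv_0_lt_compat; lra|].
      rewrite Rabs_pos_eq by lra.
      apply Rmult_le_reg_r with X; [lra|]. rewrite Rinv_l by lra.
      apply Rle_trans with ((y * IZR b - IZR a) * (IZR b + IZR d)); [nra|].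
      nra.
  - exists c, d; repeat split; try lia; try assumption.
    + apply Z.bezout_1_gcd. exists b, (-a)%Z. lia.
    + replace (y - IZR c / IZR d) with (- ((IZR c - y * IZR d) / IZR d)) by (field; lra).
      rewrite Rabs_Ropp.
      unfold Rdiv; rewrite Rabs_mult, (Rabs_pos_eq (/ _)), Rinv_mult, Rmult_comm
        by (left; apply Rinv_0_lt_compat; lra).
      apply Rmult_le_compat_l; [left; apply Rinv_0_lt_compat; lra|].
      rewrite Rabs_pos_eq by lra.
      apply Rmult_le_reg_r with X; [lra|]. rewrite Rinv_l by lra.
      apply Rle_trans with ((IZR c - y * IZR d) * (IZR b + IZR d)); [nra|].
      nra.
Qed.

(** * Weyl's inequality *)

Definition gauss_cos (y : R) (n : nat) : R :=
  rsum (fun k => cos (2 * PI * INR (S k) ^ 2 * y)) n.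

Definition gauss_sin (y : R) (n : nat) : R :=
  rsum (fun k => sin (2 * PI * INR (S k) ^ 2 * y)) n.

Definition gauss_sq (y : R) (n : nat) : R := gauss_cos y n ^ 2 + gauss_sin y n ^ 2.

(** With [K = S k] and [L = S l] the phase is [(K + L)^2 - K^2]: this is the real part of the
    correlation at lag [L], over the [n - L] pairs that fit into [1, ..., n]. *)
Definition weyl_inner (y : R) (n l : nat) : R :=
  rsum (fun k => cos (2 * PI * ((2 * INR (S k) + INR (S l)) * INR (S l)) * y)) (n - S l).

(** Expand the squared modulus and group the pairs of indices by their difference: the diagonal
    gives [n], and each other pair occurs twice with opposite phases. *)
Lemma weyl_differencing (y : R) (n : nat) :
  gauss_sq y n = INR n + 2 * rsum (weyl_inner y n) n.
Proof.
  induction n as [|n IH].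
  { unfold gauss_sq, gauss_cos, gauss_sin; simpl; ring. }
  set (th := fun k : nat => 2 * PI * INR (S k) ^ 2 * y) in *.
  assert (E1 : gauss_sq y (S n) = gauss_sq y n + 1
    + 2 * rsum (fun k => cos (th n - th k)) n).
  { change (gauss_sq y n) with
      (rsum (fun k => cos (th k)) n ^ 2 + rsum (fun k => sin (th k)) n ^ 2).
    change (gauss_sq y (S n)) with
      ((rsum (fun k => cos (th k)) n + cos (th n)) ^ 2
       + (rsum (fun k => sin (th k)) n + sin (th n)) ^ 2).
    rewrite (rsum_ext (fun k => cos (th n - th k))
      (fun k => cos (th n) * cos (th k) + sin (th n) * sin (th k)))
      by (intros; apply cos_minus).
    rewrite rsum_plus, !rsum_scal.
    set (A := rsum _ n). set (B := rsum _ n).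
    generalize (sin2_cos2 (th n)). unfold Rsqr. intros Hsc.
    rewrite <- Hsc at 1; ring. }
  assert (E2 : rsum (weyl_inner y (S n)) (S n) = rsum (weyl_inner y n) n
     + rsum (fun k => cos (th n - th k)) n).
  (* The lag [S n] has an empty sum. Every other lag gains one pair, the one ending at the new
     index; reversing the order of summation matches these pairs with the new terms. *)
  { rewrite rsum_S. unfold weyl_inner at 2. rewrite Nat.sub_diag. change (rsum _ 0) with 0.
    rewrite (rsum_rev (fun k => cos (th n - th k))), <- rsum_plus, Rplus_0_r.
    apply rsum_ext; intros l Hl. unfold weyl_inner.
    replace (S n - S l)%nat with (S (n - S l)) by lia. rewrite rsum_S. f_equal.
    unfold th. replace (S (n - 1 - l)) with (n - l)%nat by lia.
    replace (S (n - S l)) with (n - l)%nat by lia.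
    rewrite !S_INR, minus_INR by lia. f_equal. ring. }
  rewrite E1, E2, IH, S_INR; ring.
Qed.

(** Multiplication by [2 sin (th / 2)] makes the sum telescope to a difference of two sines. The
    product form remains meaningful when the sine vanishes. *)
Lemma cos_progression_bound (th c : R) (n : nat) :
  Rabs (rsum (fun k => cos (th * INR k + c)) n) * Rabs (sin (th / 2)) <= 1.
Proof.
  rewrite <- Rabs_mult.
  assert (E : 2 * (rsum (fun k => cos (th * INR k + c)) n * sin (th / 2))
    = sin (th * INR n + c - th / 2) - sin (c - th / 2)).
  { induction n as [|n IH].
    - simpl. replace (th * 0 + c - th / 2) with (c - th / 2) by ring. ring.
    - rewrite rsum_S, Rmult_plus_distr_r, Rmult_plus_distr_l, IH, S_INR.
      replace (th * (INR n + 1) + c - th / 2) with ((th * INR n + c) + th / 2) by field.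
      rewrite sin_plus, (sin_minus (th * INR n + c)). ring. }
  generalize (SIN_bound (th * INR n + c - th / 2)), (SIN_bound (c - th / 2)).
  intros. apply Rabs_le. lra.
Qed.

Lemma weyl_inner_le (y : R) (n l : nat) : Rabs (weyl_inner y n l) <= INR n.
Proof.
  unfold weyl_inner. eapply Rle_trans; [apply rsum_abs|].
  eapply Rle_trans; [apply rsum_le with (g := fun _ => 1)|].
  - intros k _; apply Rabs_le. apply COS_bound.
  - rewrite rsum_const, Rmult_1_r. apply le_INR; lia.
Qed.

(** At a fixed lag the phase is linear in [k], with step twice [2 PI (S l) y]. Writing the half step
    as [PI * (m * y)] with [m = 2 * S l] prepares the passage to consecutive [m]. *)
Lemma weyl_inner_sin (y : R) (n l : nat) :
  Rabs (weyl_inner y n l) * Rabs (sin (PI * (INR (2 * S l) * y))) <= 1.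
Proof.
  unfold weyl_inner.
  rewrite (rsum_ext _ (fun k => cos ((4 * PI * INR (S l) * y) * INR k
     + 2 * PI * (2 + INR (S l)) * INR (S l) * y))).
  2: { intros k _; f_equal; rewrite !S_INR; ring. }
  replace (PI * (INR (2 * S l) * y)) with ((4 * PI * INR (S l) * y) / 2).
  - apply cos_progression_bound.
  - rewrite mult_INR; simpl (INR 2); field.
Qed.

(** For [x = PI * w <= 2] the bound [sin x >= x - x^3 / 6] gives [sin x >= x / 3], and [PI > 3]. *)
Lemma sin_PI_lower (w : R) : 0 <= w <= 1 / 2 -> w <= sin (PI * w).
Proof.
  intros [H0 H1].
  assert (H3 : 3 < PI) by (pose proof PI2_3_2; lra).
  pose proof PI_4.
  destruct (pre_sin_bound (PI * w) 0) as [Hl _]; [nra|nra|].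
  unfold sin_approx, sin_term in Hl; simpl in Hl.
  set (x := PI * w) in *.
  assert (Hx : 0 <= x <= 2) by (unfold x; nra).
  assert (Hw : 3 * w <= x) by (unfold x; nra).
  assert (x * x <= 4) by nra.
  assert (x * (x * x) <= 4 * x) by nra.
  lra.
Qed.

Lemma abs_sin_PI_shift (k : Z) (w : R) : Rabs (sin (PI * (IZR k + w))) = Rabs (sin (PI * w)).
Proof.
  assert (nat_case : forall (n : nat) w, Rabs (sin (PI * (INR n + w))) = Rabs (sin (PI * w))).
  { induction n as [|n IH]; intros v.
    - simpl; now rewrite Rplus_0_l.
    - rewrite S_INR. replace (PI * (INR n + 1 + v)) with (PI * (INR n + v) + PI) by ring.
      rewrite neg_sin, Rabs_Ropp; apply IH. }
  destruct (Z_le_gt_dec 0 k) as [Hk|Hk].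
  - rewrite <- (Z2Nat.id k Hk), <- INR_IZR_INZ. apply nat_case.
  - rewrite <- (nat_case (Z.to_nat (- k)) (IZR k + w)).
    rewrite INR_IZR_INZ, Z2Nat.id, opp_IZR by lia. f_equal; f_equal; ring.
Qed.

Definition harmonic (n : nat) : R := rsum (fun k => / INR (S k)) n.

(* The weight of the residue [u] mod [q] when the points [m y] sit at distance about [u / q]
   to the right of an integer. *)
Definition residue_weight (N : R) (q u : nat) : R :=
  if le_lt_dec u 1 then N else INR q / INR (u - 1).

Lemma residue_weight_ge0 (N : R) (q u : nat) : 0 <= N -> 0 <= residue_weight N q u.
Proof.
  intros HN; unfold residue_weight; destruct le_lt_dec as [H|H]; [exact HN|].
  apply Rmult_le_pos; [apply pos_INR|].
  left; apply Rinv_0_lt_compat, lt_0_INR; lia.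
Qed.

Lemma residue_weight_sum (N : R) (q : nat) : 0 <= N ->
  rsum (residue_weight N q) q <= 2 * N + INR q * harmonic q.
Proof.
  intros HN.
  assert (H : forall n, rsum (residue_weight N q) n <= 2 * N + INR q * harmonic n).
  { intros n. destruct n as [|[|n]].
    - simpl; unfold harmonic; simpl; lra.
    - simpl. unfold harmonic; simpl. unfold residue_weight; simpl. pose proof (pos_INR q). lra.
    - change (S (S n)) with (2 + n)%nat at 1. rewrite rsum_add.
      apply Rplus_le_compat.
      + simpl. unfold residue_weight; simpl; lra.
      + apply Rle_trans with (INR q * harmonic n).
        * unfold harmonic. rewrite <- rsum_scal. apply rsum_le; intros k Hk.
          unfold residue_weight. destruct le_lt_dec as [H|H]; [lia|].
          replace (2 + k - 1)%nat with (S k) by lia. apply Rle_refl.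
        * apply Rmult_le_compat_l; [apply pos_INR|]. apply rsum_monotone; [|lia].
          intros k; left; apply Rinv_0_lt_compat, lt_0_INR; lia. }
  apply H.
Qed.

(** By Gauss's lemma [q] divides [j - k], whose absolute value is less than [q]. *)
Lemma residue_map_inj (p b : Z) (q j k : nat) : (0 < q)%nat -> Z.gcd p (Z.of_nat q) = 1%Z ->
  (j < q)%nat -> (k < q)%nat ->
  Z.to_nat ((b + Z.of_nat j * p) mod Z.of_nat q) = Z.to_nat ((b + Z.of_nat k * p) mod Z.of_nat q) ->
  j = k.
Proof.
  intros Hq Hg Hj Hk E.
  pose proof (Z.mod_pos_bound (b + Z.of_nat j * p) (Z.of_nat q) ltac:(lia)).
  pose proof (Z.mod_pos_bound (b + Z.of_nat k * p) (Z.of_nat q) ltac:(lia)).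
  apply Z2Nat.inj in E; try lia.
  assert (D : (Z.of_nat q | p * (Z.of_nat j - Z.of_nat k))%Z).
  { exists ((b + Z.of_nat j * p) / Z.of_nat q - (b + Z.of_nat k * p) / Z.of_nat q)%Z.
    pose proof (Z.div_mod (b + Z.of_nat j * p) (Z.of_nat q) ltac:(lia)).
    pose proof (Z.div_mod (b + Z.of_nat k * p) (Z.of_nat q) ltac:(lia)).
    nia. }
  apply Z.gauss in D; [|now rewrite Z.gcd_comm].
  destruct D as [c Hc]. assert (c = 0)%Z by nia. subst; lia.
Qed.

(** Over [q] consecutive [m], the points [m y] modulo 1 are within [O(1 / q)] of the [q] distinct
    residues divided by [q]. The sum is thus of the type of the sum of [min (N, q / u)] over the
    residues [u]. *)
Lemma block_bound (a : nat -> R) (N y : R) (p : Z) (q m0 : nat) :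
  0 <= N -> (0 < q)%nat -> Z.gcd p (Z.of_nat q) = 1%Z ->
  Rabs (y - IZR p / INR q) <= / INR q ^ 2 ->
  (forall m, 0 <= a m <= N) ->
  (forall m, a m * Rabs (sin (PI * (INR m * y))) <= 1) ->
  rsum (fun r => a (m0 + r)%nat) q <= 2 * (2 * N + INR q * harmonic q).
Proof.
  intros HN Hq Hg Hd Ha Hs.
  assert (Hq0 : 0 < INR q) by (apply lt_0_INR; lia).
  (* Rounding [q m0 y] to [b] makes [q (m0 + r) y] equal to [b + r p] up to a bounded error; [u r]
     is the residue of [b + r p]. *)
  set (b := Int_part (INR q * (INR m0 * y))).
  set (u := fun r : nat => Z.to_nat ((b + Z.of_nat r * p) mod Z.of_nat q)).
  assert (Hu : forall r, (u r < q)%nat).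
  { intros r; unfold u.
    pose proof (Z.mod_pos_bound (b + Z.of_nat r * p) (Z.of_nat q) ltac:(lia)). lia. }
  assert (Hinj : forall j k, (j < q)%nat -> (k < q)%nat -> u j = u k -> j = k).
  { intros j k; apply residue_map_inj; assumption. }
  (* The nearest integer may lie on either side, so [r] is charged both for [u r] and for its
     reflection [q - 1 - u r]; each of them takes every residue at most once. *)
  apply Rle_trans with (rsum (fun r => residue_weight N q (u r)
     + residue_weight N q (q - 1 - u r)) q).
  2: { rewrite rsum_plus.
    assert (rsum (fun r => residue_weight N q (u r)) q <= rsum (residue_weight N q) q).
    { apply rsum_reindex; auto. intros; now apply residue_weight_ge0. }
    assert (rsum (fun r => residue_weight N q (q - 1 - u r)) q <= rsum (residue_weight N q) q).
    { apply (rsum_reindex _ (fun r => q - 1 - u r)%nat).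
      - intros; now apply residue_weight_ge0.
      - intros; lia.
      - intros j k Hj Hk E; apply Hinj; auto. pose proof (Hu j); pose proof (Hu k); lia. }
    pose proof (residue_weight_sum N q HN). lra. }
  apply rsum_le; intros r Hr.
  pose proof (residue_weight_ge0 N q (u r) HN) as P1.
  pose proof (residue_weight_ge0 N q (q - 1 - u r) HN) as P2.
  destruct (le_lt_dec (u r) 1) as [H1|H1].
  { apply Rle_trans with N; [apply Ha|]. unfold residue_weight in P1 |- * at 1.
    destruct (le_lt_dec (u r) 1); [lra|lia]. }
  destruct (le_lt_dec (q - 1 - u r) 1) as [H2|H2].
  { apply Rle_trans with N; [apply Ha|]. unfold residue_weight in P2 |- * at 2.
    destruct (le_lt_dec (q - 1 - u r) 1); [lra|lia]. }
  set (k := ((b + Z.of_nat r * p) / Z.of_nat q)%Z).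
  assert (Ek : IZR b + INR r * IZR p = INR q * IZR k + INR (u r)).
  { rewrite !INR_IZR_INZ. unfold u. rewrite Z2Nat.id.
    2: { apply Z.mod_pos_bound; lia. }
    rewrite <- !mult_IZR, <- !plus_IZR. f_equal. apply Z.div_mod; lia. }
  set (d := y - IZR p / INR q) in *.
  (* The error [t] is a fractional part plus the drift [q r d], of size at most 1. Its range
     [[-1, 2]] explains the shift [u - 1] in the weights, on either side. *)
  set (t := INR q * (INR m0 * y) - IZR b + INR q * (INR r * d)).
  assert (Ht : -1 <= t <= 2).
  { destruct (base_Int_part (INR q * (INR m0 * y))) as [B1 B2]. fold b in B1, B2.
    assert (Hrd : Rabs (INR q * (INR r * d)) <= 1).
    { rewrite !Rabs_mult, !Rabs_pos_eq by apply pos_INR.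
      assert (INR r <= INR q) by (apply le_INR; lia).
      apply Rle_trans with (INR q * (INR q * / INR q ^ 2)).
      - apply Rmult_le_compat_l; [lra|]. apply Rmult_le_compat; auto using pos_INR, Rabs_pos.
      - right; field; lra. }
    apply Rabs_le_between in Hrd. unfold t; lra. }
  set (w := (INR (u r) + t) / INR q).
  assert (Ez : INR (m0 + r) * y = IZR k + w).
  { unfold w. apply Rmult_eq_reg_l with (INR q); [|lra].
    replace (INR q * (IZR k + (INR (u r) + t) / INR q))
      with (INR q * IZR k + INR (u r) + t) by (field; lra).
    rewrite <- Ek. unfold t, d. rewrite plus_INR. field; lra. }
  specialize (Hs (m0 + r)%nat). rewrite Ez, abs_sin_PI_shift in Hs.
  pose proof (Hu r) as Hur.
  assert (Hw1 : INR (u r - 1) / INR q <= w).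
  { unfold w, Rdiv. apply Rmult_le_compat_r; [left; now apply Rinv_0_lt_compat|].
    rewrite minus_INR by lia. simpl (INR 1). lra. }
  assert (Hw2 : INR (q - 1 - u r - 1) / INR q <= 1 - w).
  { unfold w. replace (1 - (INR (u r) + t) / INR q) with ((INR q - INR (u r) - t) / INR q)
      by (field; lra).
    unfold Rdiv. apply Rmult_le_compat_r; [left; now apply Rinv_0_lt_compat|].
    rewrite !minus_INR by lia. simpl (INR 1). lra. }
  assert (aux : forall v, (0 < v)%nat -> forall x, INR v / INR q <= x -> x <= Rabs (sin (PI * w)) ->
    a (m0 + r)%nat <= INR q / INR v).
  { intros v Hv x Hx Hsx.
    assert (Hv0 : 0 < INR v) by (apply lt_0_INR; lia).
    assert (Hvq : 0 < INR v / INR q) by (apply Rdiv_lt_0_compat; lra).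
    apply Rmult_le_reg_r with (INR v / INR q); [lra|].
    replace (INR q / INR v * (INR v / INR q)) with 1 by (field; lra).
    eapply Rle_trans; [|apply Hs]. apply Rmult_le_compat_l; [apply Ha|lra]. }
  assert (Hw0 : 0 <= w <= 1).
  { assert (0 <= INR (u r - 1) / INR q) by (apply Rdiv_le_0_compat; [apply pos_INR|lra]).
    assert (0 <= INR (q - 1 - u r - 1) / INR q) by (apply Rdiv_le_0_compat; [apply pos_INR|lra]).
    lra. }
  destruct (Rle_lt_dec w (1 / 2)) as [Hw|Hw].
  - assert (a (m0 + r)%nat <= residue_weight N q (u r)).
    { unfold residue_weight; destruct le_lt_dec; [lia|].
      apply aux with w; [lia|exact Hw1|].
      eapply Rle_trans; [|apply Rle_abs]. apply sin_PI_lower; lra. }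
    lra.
  - assert (a (m0 + r)%nat <= residue_weight N q (q - 1 - u r)).
    { unfold residue_weight; destruct le_lt_dec; [lia|].
      apply aux with (1 - w); [lia|exact Hw2|].
      eapply Rle_trans; [|apply Rle_abs].
      replace (PI * w) with (PI - PI * (1 - w)) by ring.
      rewrite sin_minus, sin_PI, cos_PI.
      pose proof (sin_PI_lower (1 - w)). lra. }
    lra.
Qed.

Lemma harmonic_ge1 (n : nat) : (0 < n)%nat -> 1 <= harmonic n.
Proof.
  intros Hn. apply Rle_trans with (harmonic 1); [unfold harmonic; simpl; lra|].
  apply rsum_monotone; [|lia]. intros k; left; apply Rinv_0_lt_compat, lt_0_INR; lia.
Qed.

(** After differencing, the lag [S l] is controlled by the distance of [2 * S l * y] to the
    integers. The multipliers [m <= 2 n] form about [n / q + 1] blocks of length [q], each costing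
    [n + q * harmonic q] up to a constant. *)
Lemma weyl_bound (y : R) (p : Z) (q n : nat) :
  (0 < q)%nat -> (0 < n)%nat -> Z.gcd p (Z.of_nat q) = 1%Z ->
  Rabs (y - IZR p / INR q) <= / INR q ^ 2 ->
  gauss_sq y n <= 24 * harmonic q * (INR n ^ 2 / INR q + INR n + INR q).
Proof.
  intros Hq Hn Hg Hd.
  assert (Hq0 : 0 < INR q) by (apply lt_0_INR; lia).
  assert (Hn1 : 1 <= INR n) by (apply (le_INR 1); lia).
  pose proof (harmonic_ge1 q Hq) as Hh.
  (* Only the even multipliers [m = 2 * S l] carry a correlation; the value 0 elsewhere allows
     summation over blocks of consecutive [m]. *)
  set (a := fun m : nat => if Nat.even m then
      match Nat.div2 m with O => 0 | S l => Rabs (weyl_inner y n l) end else 0).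
  assert (Ha : forall m, 0 <= a m <= INR n).
  { intros m; unfold a. destruct (Nat.even m); [|lra]. destruct (Nat.div2 m); [lra|].
    split; [apply Rabs_pos|apply weyl_inner_le]. }
  assert (Hs : forall m, a m * Rabs (sin (PI * (INR m * y))) <= 1).
  { intros m; unfold a. destruct (Nat.even m) eqn:E; [|lra].
    destruct (Nat.div2 m) eqn:E2; [lra|].
    replace m with (2 * S n0)%nat; [apply weyl_inner_sin|].
    apply Nat.even_spec in E. rewrite <- E2, <- Nat.double_twice.
    symmetry; apply Nat.Even_double; exact E. }
  assert (Hblocks : forall B, rsum a (B * q) <= INR B * (2 * (2 * INR n + INR q * harmonic q))).
  { induction B as [|B IH]; [simpl; lra|].
    replace (S B * q)%nat with (B * q + q)%nat by lia.
    rewrite rsum_add, S_INR, Rmult_plus_distr_r, Rmult_1_l.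
    apply Rplus_le_compat; [exact IH|].
    apply block_bound with (y := y) (p := p); auto; lra. }
  assert (Hev : forall k, rsum (fun l => Rabs (weyl_inner y n l)) k <= rsum a (2 * k + 1)).
  { induction k as [|k IH]; [simpl; pose proof (Ha 0%nat); lra|].
    replace (2 * S k + 1)%nat with (S (S (2 * k + 1))) by lia. rewrite !rsum_S.
    pose proof (Ha (2 * k + 1)%nat).
    assert (a (S (2 * k + 1)) = Rabs (weyl_inner y n k)).
    { unfold a. replace (S (2 * k + 1)) with (2 * S k)%nat by lia.
      rewrite Nat.even_mul, Nat.div2_double. reflexivity. }
    lra. }
  set (B := S ((2 * n + 1) / q)).
  assert (HB : (2 * n + 1 <= B * q)%nat).
  { unfold B. pose proof (Nat.div_mod_eq (2 * n + 1) q).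
    pose proof (Nat.mod_upper_bound (2 * n + 1) q ltac:(lia)). nia. }
  assert (HBR : INR B <= 3 * INR n / INR q + 1).
  { unfold B; rewrite S_INR. apply Rplus_le_compat_r.
    apply Rmult_le_reg_r with (INR q); [lra|].
    replace (3 * INR n / INR q * INR q) with (3 * INR n) by (field; lra).
    rewrite <- mult_INR. apply Rle_trans with (INR (2 * n + 1)).
    - apply le_INR. rewrite Nat.mul_comm. apply Nat.Div0.mul_div_le.
    - rewrite plus_INR, mult_INR; simpl (INR 2); simpl (INR 1); lra. }
  rewrite weyl_differencing.
  assert (H1 : rsum (weyl_inner y n) n <= INR B * (2 * (2 * INR n + INR q * harmonic q))).
  { eapply Rle_trans; [|apply Hblocks].
    eapply Rle_trans; [|apply (rsum_monotone a (2 * n + 1)); [intros; apply Ha|exact HB]].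
    eapply Rle_trans; [|apply Hev].
    apply rsum_le; intros; apply Rle_abs. }
  set (h := harmonic q) in *. set (N := INR n) in *. set (Q := INR q) in *.
  assert (H2 : INR B * (2 * (2 * N + Q * h)) <= (3 * N / Q + 1) * (2 * (2 * N + Q * h))).
  { apply Rmult_le_compat_r; [nra|exact HBR]. }
  assert (E : (3 * N / Q + 1) * (2 * (2 * N + Q * h)) = 12 * (N ^ 2 / Q) + 6 * N * h + 4 * N + 2 * Q * h)
    by (field; lra).
  rewrite E in H2.
  assert (0 < N ^ 2 / Q) by (apply Rdiv_lt_0_compat; nra).
  set (Z := N ^ 2 / Q) in *.
  assert (Z <= h * Z) by nra. assert (N <= h * N) by nra. assert (Q <= h * Q) by nra.
  nra.
Qed.

(** * Real powers *)

Lemma exp_monotone (x y : R) : x <= y -> exp x <= exp y.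
Proof. intros [H| ->]; [left; now apply exp_increasing | apply Rle_refl]. Qed.

Lemma Rpower_pos (x a : R) : 0 < Rpower x a.
Proof. apply exp_pos. Qed.

Lemma Rpower_1_l (a : R) : Rpower 1 a = 1.
Proof. unfold Rpower; rewrite ln_1, Rmult_0_r; apply exp_0. Qed.

Lemma Rpower_ge1 (x a : R) : 1 <= x -> 0 <= a -> 1 <= Rpower x a.
Proof. intros Hx Ha; rewrite <- (Rpower_O x) by lra. apply Rle_Rpower; lra. Qed.

Lemma Rpower_antitone (x a b : R) : 0 < x <= 1 -> a <= b -> Rpower x b <= Rpower x a.
Proof.
  intros Hx Hab. unfold Rpower. apply exp_monotone.
  assert (ln x <= 0) by (rewrite <- ln_1; apply ln_le; lra). nra.
Qed.

Lemma Rpower_le1 (x a : R) : 0 < x <= 1 -> 0 <= a -> Rpower x a <= 1.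
Proof. intros Hx Ha; rewrite <- (Rpower_O x) by lra. apply Rpower_antitone; lra. Qed.

Lemma Rpower_le_base (x y a : R) : 0 <= a -> 0 < x <= y -> Rpower x a <= Rpower y a.
Proof. intros; apply Rle_Rpower_l; lra. Qed.

Lemma Rpower_neg_base (x y a : R) : a <= 0 -> 0 < x <= y -> Rpower y a <= Rpower x a.
Proof.
  intros Ha Hx. unfold Rpower. apply exp_monotone.
  assert (ln x <= ln y) by (apply ln_le; lra). nra.
Qed.

Lemma Rpower_sqr (x a : R) : Rpower x a ^ 2 = Rpower x (2 * a).
Proof. simpl; rewrite Rmult_1_r, <- Rpower_plus; f_equal; ring. Qed.

(** From [ln (x + 1) - ln x >= 1 / (x + 1)] and [exp u >= 1 + u]. This discrete form of the
    derivative of a power makes both the harmonic sums and the tails below telescope. *)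
Lemma Rpower_succ_ratio (x e : R) : 0 < x -> 0 <= e ->
  Rpower x e * (1 + e / (x + 1)) <= Rpower (x + 1) e.
Proof.
  intros Hx He.
  assert (Hl : / (x + 1) <= ln (x + 1) - ln x).
  { assert (H : ln (x / (x + 1)) <= x / (x + 1) - 1).
    { assert (Hp : 0 < x / (x + 1)) by (apply Rdiv_lt_0_compat; lra).
      generalize (exp_ineq1_le (ln (x / (x + 1)))). rewrite exp_ln by exact Hp. lra. }
    rewrite ln_div in H by lra.
    replace (x / (x + 1) - 1) with (- / (x + 1)) in H by (field; lra). lra. }
  replace (Rpower (x + 1) e) with (Rpower x e * exp (e * (ln (x + 1) - ln x))).
  2: { unfold Rpower. rewrite <- exp_plus. f_equal; ring. }
  apply Rmult_le_compat_l; [left; apply Rpower_pos|].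
  eapply Rle_trans; [|apply exp_ineq1_le].
  unfold Rdiv; nra.
Qed.

Lemma harmonic_le (e : R) (n : nat) : 0 < e -> (0 < n)%nat ->
  harmonic n <= (1 + / e) * Rpower (INR n) e.
Proof.
  intros He Hn.
  (* The right side is 1 plus the integral of [x^(e - 1)] over [[1, S n]], a sharper form that
     passes through the induction. *)
  assert (H : forall n, harmonic (S n) <= 1 + / e * (Rpower (INR (S n)) e - 1)).
  { intros m; induction m as [|m IH].
    - simpl (INR 1). rewrite Rpower_1_l. unfold harmonic; simpl; lra.
    - unfold harmonic in *. rewrite rsum_S.
      assert (Hm : 1 <= INR (S m)) by (apply (le_INR 1); lia).
      pose proof (Rpower_succ_ratio (INR (S m)) e ltac:(lra) ltac:(lra)) as H1.
      rewrite <- S_INR in H1.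
      pose proof (Rpower_ge1 (INR (S m)) e Hm ltac:(lra)) as H2.
      assert (Hi : 0 < / INR (S (S m))) by (apply Rinv_0_lt_compat, lt_0_INR; lia).
      assert (H3 : Rpower (INR (S m)) e + e * / INR (S (S m)) <= Rpower (INR (S (S m))) e).
      { eapply Rle_trans; [|exact H1]. unfold Rdiv.
        assert (0 < e * / INR (S (S m))) by nra. nra. }
      assert (H4 : / INR (S (S m)) <= / e * (Rpower (INR (S (S m))) e - Rpower (INR (S m)) e)).
      { apply Rmult_le_reg_l with e; [lra|].
        rewrite <- Rmult_assoc, Rinv_r, Rmult_1_l by lra. lra. }
      lra. }
  destruct n as [|n]; [lia|].
  eapply Rle_trans; [apply H|].
  pose proof (Rpower_ge1 (INR (S n)) e ltac:(apply (le_INR 1); lia) ltac:(lra)).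
  assert (0 < / e) by now apply Rinv_0_lt_compat. nra.
Qed.

Lemma power_tail (tau : R) (m n : nat) : 0 < tau -> (0 < m)%nat ->
  rsum (fun k => Rpower (INR (m + S k)) (- 1 - tau)) n
    <= / tau * Rpower (INR m) (- tau).
Proof.
  intros Ht Hm.
  assert (Hi : 0 < / tau) by now apply Rinv_0_lt_compat.
  assert (H : rsum (fun k => Rpower (INR (m + S k)) (- 1 - tau)) n
    <= / tau * (Rpower (INR m) (- tau) - Rpower (INR (m + n)) (- tau))).
  { induction n as [|n IH].
    - rewrite Nat.add_0_r; simpl; lra.
    - rewrite rsum_S.
      assert (Hp : 0 < INR (m + n)) by (apply lt_0_INR; lia).
      replace (m + S n)%nat with (S (m + n)) by lia.
      pose proof (Rpower_succ_ratio (INR (m + n)) tau Hp ltac:(lra)) as H1.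
      rewrite <- S_INR in H1. set (x := INR (m + n)) in *. set (x' := INR (S (m + n))) in *.
      assert (Hx' : 0 < x') by (unfold x'; apply lt_0_INR; lia).
      assert (H2 : Rpower x' (- tau) * (1 + tau / x') <= Rpower x (- tau)).
      { rewrite !Rpower_Ropp.
        pose proof (Rpower_pos x tau); pose proof (Rpower_pos x' tau).
        apply Rmult_le_reg_l with (Rpower x tau); [lra|].
        apply Rmult_le_reg_l with (Rpower x' tau); [lra|].
        replace (Rpower x' tau * (Rpower x tau * (/ Rpower x' tau * (1 + tau / x'))))
          with (Rpower x tau * (1 + tau / x')) by (field; lra).
        replace (Rpower x' tau * (Rpower x tau * / Rpower x tau)) with (Rpower x' tau)
          by (field; lra).
        exact H1. }
      assert (E : Rpower x' (- 1 - tau) = Rpower x' (- tau) * / x').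
      { replace (- 1 - tau) with (- tau + - (1)) by ring.
        rewrite Rpower_plus, (Rpower_Ropp x' 1), Rpower_1 by exact Hx'. reflexivity. }
      assert (H3 : Rpower x' (- 1 - tau) <= / tau * (Rpower x (- tau) - Rpower x' (- tau))).
      { rewrite E. apply Rmult_le_reg_l with tau; [lra|].
        rewrite <- (Rmult_assoc tau (/ tau)), Rinv_r, Rmult_1_l by lra. unfold Rdiv in H2. lra. }
      lra. }
  pose proof (Rpower_pos (INR (m + n)) (- tau)). nra.
Qed.

Lemma power_tail_small (tau eps : R) : 0 < tau -> 0 < eps ->
  exists m, (0 < m)%nat /\
    forall n, rsum (fun k => Rpower (INR (m + S k)) (- 1 - tau)) n <= eps.
Proof.
  intros Ht He.
  (* This [x] solves [x^(-tau) / tau = eps], the bound of [power_tail]. *)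
  set (x := Rpower (tau * eps) (- / tau)).
  assert (Hx : 0 < x) by apply Rpower_pos.
  destruct (nfloor_ex x ltac:(lra)) as [m [Hm1 Hm2]].
  exists (S m); split; [lia|]. intros n.
  eapply Rle_trans; [apply power_tail; [exact Ht|lia]|].
  apply Rmult_le_reg_l with tau; [lra|].
  rewrite <- Rmult_assoc, Rinv_r, Rmult_1_l by lra.
  apply Rle_trans with (Rpower x (- tau)).
  - apply Rpower_neg_base; [lra|]. rewrite S_INR; lra.
  - unfold x. rewrite Rpower_mult.
    replace (- / tau * - tau) with 1 by (field; lra). rewrite Rpower_1; nra.
Qed.

(** * Weyl's inequality with power losses, and summation by parts *)

Lemma weyl_bound_pow (e y : R) (p : Z) (q n : nat) :
  0 < e -> (0 < q)%nat -> (0 < n)%nat -> Z.gcd p (Z.of_nat q) = 1%Z ->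
  Rabs (y - IZR p / INR q) <= / INR q ^ 2 ->
  gauss_sq y n <= 24 * (1 + / e) * Rpower (INR q) e * (INR n ^ 2 / INR q + INR n + INR q).
Proof.
  intros He Hq Hn Hg Hd.
  eapply Rle_trans; [apply (weyl_bound y p q n); assumption|].
  assert (0 < INR q) by (apply lt_0_INR; lia).
  assert (0 < INR n) by (apply lt_0_INR; lia).
  assert (0 < INR n ^ 2 / INR q) by (apply Rdiv_lt_0_compat; nra).
  apply Rmult_le_compat_r; [lra|].
  pose proof (harmonic_le e q He Hq). lra.
Qed.

(** Partial sums of size [M m^(3/2)] against weight differences of size [2 / m^3] leave terms of
    order [m^(-3/2)], whose tail beyond [K] is of order [K^(-1/2)]. *)
Lemma abel_tail (a : nat -> R) (M : R) (K n : nat) :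
  (0 < K)%nat -> (K <= n)%nat ->
  (forall m, (K <= m)%nat -> Rabs (rsum a m) <= M * (INR m * sqrt (INR m))) ->
  Rabs (rsum (fun k => a k / INR (S k) ^ 2) n - rsum (fun k => a k / INR (S k) ^ 2) K)
    <= 6 * M / sqrt (INR K).
Proof.
  intros HK Hn HM.
  set (T := rsum (fun k => a k / INR (S k) ^ 2)).
  (* With the boundary term removed, an increment of [U] is the next partial sum times a difference
     of consecutive weights. *)
  set (U := fun m => T m - rsum a m / INR (S m) ^ 2).
  assert (HM0 : 0 <= M).
  { specialize (HM K (le_n K)). pose proof (Rabs_pos (rsum a K)).
    assert (0 < INR K) by (apply lt_0_INR; lia).
    assert (0 < sqrt (INR K)) by (apply sqrt_lt_R0; lra).
    assert (0 < INR K * sqrt (INR K)) by nra.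
    destruct (Rle_lt_dec 0 M); [assumption|nra]. }
  assert (Hs : forall m, (K <= m)%nat -> 0 < sqrt (INR m) /\ sqrt (INR m) * sqrt (INR m) = INR m
     /\ 1 <= INR m).
  { intros m Hm. assert (1 <= INR m) by (apply (le_INR 1); lia).
    repeat split; [apply sqrt_lt_R0; lra|apply sqrt_sqrt; lra|lra]. }
  assert (Hinv : forall m, (K <= m)%nat -> / sqrt (INR m) <= / sqrt (INR K)).
  { intros m Hm. apply Rinv_le_contravar; [apply Hs; lia|]. apply sqrt_le_1_alt, le_INR, Hm. }
  assert (Hend : forall m, (K <= m)%nat -> Rabs (rsum a m / INR (S m) ^ 2) <= M / sqrt (INR K)).
  { intros m Hm. destruct (Hs m Hm) as (s1 & s2 & s3).
    apply Rle_trans with (M / sqrt (INR m)).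
    2: { apply Rmult_le_compat_l; auto. }
    unfold Rdiv. rewrite Rabs_mult, (Rabs_pos_eq (/ _)).
    2: { left; apply Rinv_0_lt_compat, pow_lt, lt_0_INR; lia. }
    apply Rmult_le_reg_r with (INR (S m) ^ 2); [apply pow_lt, lt_0_INR; lia|].
    rewrite Rmult_assoc, Rinv_l, Rmult_1_r by (apply pow_nonzero, not_0_INR; lia).
    eapply Rle_trans; [apply HM, Hm|].
    rewrite Rmult_assoc. apply Rmult_le_compat_l; [exact HM0|].
    apply Rmult_le_reg_l with (sqrt (INR m)); [lra|].
    replace (sqrt (INR m) * (/ sqrt (INR m) * INR (S m) ^ 2)) with (INR (S m) ^ 2) by (field; lra).
    replace (sqrt (INR m) * (INR m * sqrt (INR m))) with (INR m ^ 2) by (rewrite <- s2 at 1; ring [s2]).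
    rewrite S_INR. nra. }
  assert (HU : forall m, (K <= m)%nat ->
     Rabs (U m - U K) <= 4 * M * (/ sqrt (INR K) - / sqrt (INR m))).
  { intros m Hm; induction Hm as [|m Hm IH].
    - unfold Rminus; rewrite !Rplus_opp_r, Rabs_R0; lra.
    - replace (U (S m) - U K) with ((U (S m) - U m) + (U m - U K)) by ring.
      eapply Rle_trans; [apply Rabs_triang|].
      enough (Rabs (U (S m) - U m) <= 4 * M * (/ sqrt (INR m) - / sqrt (INR (S m)))) by lra.
      destruct (Hs m Hm) as (s1 & s2 & s3). destruct (Hs (S m) ltac:(lia)) as (r1 & r2 & r3).
      assert (E : U (S m) - U m = rsum a (S m) * (/ INR (S m) ^ 2 - / INR (S (S m)) ^ 2)).
      { unfold U, T. rewrite !rsum_S. rewrite !S_INR. field; lra. }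
      rewrite E, Rabs_mult.
      assert (Hd : 0 <= / INR (S m) ^ 2 - / INR (S (S m)) ^ 2 <= 2 / INR (S m) ^ 3).
      { rewrite (S_INR (S m)). set (x := INR (S m)) in *.
        replace (/ x ^ 2 - / (x + 1) ^ 2) with ((2 * x + 1) / (x ^ 2 * (x + 1) ^ 2))
          by (field; lra).
        assert (0 < x ^ 2 * (x + 1) ^ 2) by (apply Rmult_lt_0_compat; apply pow_lt; lra).
        split; [apply Rdiv_le_0_compat; lra|].
        apply Rmult_le_reg_r with (x ^ 3 * (x + 1) ^ 2).
        { apply Rmult_lt_0_compat; apply pow_lt; lra. }
        replace ((2 * x + 1) / (x ^ 2 * (x + 1) ^ 2) * (x ^ 3 * (x + 1) ^ 2))
          with ((2 * x + 1) * x) by (field; lra).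
        replace (2 / x ^ 3 * (x ^ 3 * (x + 1) ^ 2)) with (2 * (x + 1) ^ 2) by (field; lra).
        nra. }
      rewrite (Rabs_pos_eq (_ - _)) by apply Hd.
      apply Rle_trans with (M * (INR (S m) * sqrt (INR (S m))) * (2 / INR (S m) ^ 3)).
      { apply Rmult_le_compat; [apply Rabs_pos|apply Hd|apply HM; lia|apply Hd]. }
      set (r := sqrt (INR (S m))) in *. set (s := sqrt (INR m)) in *.
      assert (Hrs : s <= r) by (apply sqrt_le_1_alt, le_INR; lia).
      assert (Hr2 : r * r = s * s + 1) by (rewrite r2, s2, S_INR; ring).
      rewrite <- r2.
      replace (M * (r * r * r) * (2 / (r * r) ^ 3)) with (2 * M * / (r * r * r)) by (field; lra).
      replace (/ s - / r) with ((r * r - s * s) / (s * r * (r + s))) by (field; lra).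
      replace (r * r - s * s) with 1 by lra.
      replace (4 * M * (1 / (s * r * (r + s)))) with (2 * M * (2 / (s * r * (r + s))))
        by (field; lra).
      apply Rmult_le_compat_l; [lra|].
      assert (0 < r * r * r) by (repeat apply Rmult_lt_0_compat; lra).
      assert (0 < s * r * (r + s)) by (repeat apply Rmult_lt_0_compat; lra).
      apply Rmult_le_reg_r with (r * r * r); [lra|]. replace (/ (r * r * r) * (r * r * r)) with 1 by (field; lra).
      apply Rmult_le_reg_r with (s * r * (r + s)); [lra|].
      replace (2 / (s * r * (r + s)) * (r * r * r) * (s * r * (r + s))) with (2 * (r * r * r))
        by (field; lra).
      rewrite Rmult_1_l.
      assert (s * r <= r * r) by nra. assert (0 < s * r) by nra. nra. }
  (* The constant 6 is 4 from the telescoping majorant and 1 from each of the two boundary terms. *)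
  replace (T n - T K) with ((U n - U K) + (rsum a n / INR (S n) ^ 2) - rsum a K / INR (S K) ^ 2)
    by (unfold U; ring).
  pose proof (HU n Hn) as B1. pose proof (Hend n Hn) as B2. pose proof (Hend K (le_n K)) as B3.
  destruct (Hs n Hn) as (s1 & _ & _).
  assert (0 < / sqrt (INR n)) by (apply Rinv_0_lt_compat; exact s1).
  assert (B4 : 4 * M * (/ sqrt (INR K) - / sqrt (INR n)) <= 4 * M * / sqrt (INR K)) by nra.
  unfold Rdiv in *.
  apply Rabs_le. apply Rabs_le_between in B1, B2, B3. lra.
Qed.

(** * Increments of phi *)

Lemma rsum_is_derive (f df : nat -> R -> R) (n : nat) (x : R) :
  (forall k, is_derive (f k) x (df k x)) ->
  is_derive (fun y => rsum (fun k => f k y) n) x (rsum (fun k => df k x) n).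
Proof.
  intros H; induction n as [|n IH]; simpl.
  - apply (is_derive_const (K := R_AbsRing) 0 x).
  - apply (is_derive_plus (fun y => rsum (fun k => f k y) n) (f n)); auto.
Qed.

Lemma increment_le (f df : R -> R) (y v B : R) :
  (forall x, is_derive f x (df x)) ->
  (forall x, Rabs (x - y) <= Rabs v -> Rabs (df x) <= B) ->
  Rabs (f (y + v) - f y) <= B * Rabs v.
Proof.
  intros Hd HB.
  destruct (MVT_gen f y (y + v) df) as (c & Hc & E).
  - intros x _; apply Hd.
  - intros x _. apply derivable_continuous_pt. exists (df x). apply is_derive_Reals, Hd.
  - rewrite E, Rabs_mult. replace (y + v - y) with v by ring.
    apply Rmult_le_compat_r; [apply Rabs_pos|]. apply HB.
    unfold Rmin, Rmax in Hc. destruct (Rle_dec y (y + v)).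
    + rewrite !Rabs_pos_eq; lra.
    + rewrite !Rabs_left1; lra.
Qed.

Lemma sqr_le_abs (a b M : R) : 0 <= M -> a ^ 2 + b ^ 2 <= M ^ 2 -> Rabs a <= M /\ Rabs b <= M.
Proof.
  intros HM H; split; rewrite <- (Rabs_pos_eq M HM); apply Rsqr_le_abs_0; unfold Rsqr; nra.
Qed.

(* The mean value theorem controls the frequencies up to [K ~ |v|^(-1/2)],
   summation by parts those beyond. *)
Lemma trig_increment (trig dtrig : R -> R) (y v M : R) (K n : nat) :
  (0 < K)%nat -> Rabs v * INR K ^ 2 <= 4 -> 0 <= M ->
  (forall c x, is_derive (fun z => trig (c * z)) x (c * dtrig (c * x))) ->
  (forall m x, (K <= m)%nat -> Rabs (x - y) <= Rabs v ->
     Rabs (rsum (fun k => trig (2 * PI * INR (S k) ^ 2 * x)) m) <= M * (INR m * sqrt (INR m))) ->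
  (forall x, Rabs (x - y) <= Rabs v ->
     Rabs (rsum (fun k => dtrig (2 * PI * INR (S k) ^ 2 * x)) K) <= M * (INR K * sqrt (INR K))) ->
  (K <= n)%nat ->
  Rabs (rsum (fun k => trig (2 * PI * INR (S k) ^ 2 * (y + v)) / INR (S k) ^ 2) n
      - rsum (fun k => trig (2 * PI * INR (S k) ^ 2 * y) / INR (S k) ^ 2) n)
    <= 44 * M / sqrt (INR K).
Proof.
  intros HK HvK HM0 Hder Ht Hdt Hn.
  set (F := fun x m => rsum (fun k => trig (2 * PI * INR (S k) ^ 2 * x) / INR (S k) ^ 2) m).
  change (Rabs (F (y + v) n - F y n) <= 44 * M / sqrt (INR K)).
  assert (T1 : Rabs (F (y + v) n - F (y + v) K) <= 6 * M / sqrt (INR K)).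
  { apply (abel_tail (fun k => trig (2 * PI * INR (S k) ^ 2 * (y + v)))); auto.
    intros m Hm; apply Ht; [exact Hm|]. right; f_equal; ring. }
  assert (T2 : Rabs (F y n - F y K) <= 6 * M / sqrt (INR K)).
  { apply (abel_tail (fun k => trig (2 * PI * INR (S k) ^ 2 * y))); auto.
    intros m Hm; apply Ht; [exact Hm|]. unfold Rminus; rewrite Rplus_opp_r, Rabs_R0; apply Rabs_pos. }
  assert (HK1 : 1 <= INR K) by (apply (le_INR 1); lia).
  assert (Hs : 0 < sqrt (INR K)) by (apply sqrt_lt_R0; lra).
  assert (Hss : sqrt (INR K) * sqrt (INR K) = INR K) by (apply sqrt_sqrt; lra).
  pose proof PI_4 as HPI. pose proof PI_RGT_0 as HPI0.
  (* Differentiation brings out [2 PI k^2], which cancels the weight [1 / k^2]: the derivative of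
     the low frequencies is again a quadratic sum. *)
  assert (T3 : Rabs (F (y + v) K - F y K) <= (2 * PI * (M * (INR K * sqrt (INR K)))) * Rabs v).
  { apply (increment_le (fun x => F x K)
      (fun x => rsum (fun k => 2 * PI * dtrig (2 * PI * INR (S k) ^ 2 * x)) K)).
    - intros x. apply (rsum_is_derive (fun k x => trig (2 * PI * INR (S k) ^ 2 * x) / INR (S k) ^ 2)
        (fun k x => 2 * PI * dtrig (2 * PI * INR (S k) ^ 2 * x))).
      intros k. assert (0 < INR (S k)) by (apply lt_0_INR; lia).
      apply (is_derive_ext (fun z => / INR (S k) ^ 2 * trig (2 * PI * INR (S k) ^ 2 * z))).
      { intros z; unfold Rdiv; apply Rmult_comm. }
      replace (2 * PI * dtrig (2 * PI * INR (S k) ^ 2 * x)) with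
        (/ INR (S k) ^ 2 * ((2 * PI * INR (S k) ^ 2) * dtrig (2 * PI * INR (S k) ^ 2 * x)))
        by (field; lra).
      apply (is_derive_scal (fun z => trig (2 * PI * INR (S k) ^ 2 * z))).
      apply Hder.
    - intros x Hx. rewrite rsum_scal, Rabs_mult, Rabs_pos_eq by lra.
      apply Rmult_le_compat_l; [lra|]. apply Hdt, Hx. }
  (* [2 PI <= 8] and [|v| K^2 <= 4] give 32; the two tails add 12, whence 44. *)
  assert (T4 : (2 * PI * (M * (INR K * sqrt (INR K)))) * Rabs v <= 32 * M / sqrt (INR K)).
  { apply Rmult_le_reg_r with (sqrt (INR K)); [exact Hs|].
    replace (32 * M / sqrt (INR K) * sqrt (INR K)) with (32 * M) by (field; lra).
    replace (2 * PI * (M * (INR K * sqrt (INR K))) * Rabs v * sqrt (INR K))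
      with (2 * PI * M * (Rabs v * (INR K * (sqrt (INR K) * sqrt (INR K))))) by ring.
    rewrite Hss. replace (INR K * INR K) with (INR K ^ 2) by ring.
    assert (0 <= Rabs v * INR K ^ 2) by (apply Rmult_le_pos; [apply Rabs_pos|nra]).
    assert (0 <= PI * M) by nra.
    assert (PI * M <= 4 * M) by nra. nra. }
  unfold Rdiv in *. apply Rabs_le.
  apply Rabs_le_between in T1, T2, T3. lra.
Qed.

Lemma gauss_abs_le (x B : R) (n : nat) : 0 <= B -> gauss_sq x n <= (B * (INR n * sqrt (INR n))) ^ 2 ->
  Rabs (gauss_cos x n) <= B * (INR n * sqrt (INR n)) /\
  Rabs (gauss_sin x n) <= B * (INR n * sqrt (INR n)).
Proof.
  intros HB; apply sqr_le_abs. apply Rmult_le_pos; [exact HB|].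
  apply Rmult_le_pos; [apply pos_INR|apply sqrt_pos].
Qed.

Lemma cos_increment (y v M : R) (K n : nat) :
  (0 < K)%nat -> Rabs v * INR K ^ 2 <= 4 -> 0 <= M ->
  (forall n x, (K <= n)%nat -> Rabs (x - y) <= Rabs v ->
     gauss_sq x n <= (M * (INR n * sqrt (INR n))) ^ 2) ->
  (K <= n)%nat ->
  Rabs (rsum (fun k => cos (2 * PI * INR (S k) ^ 2 * (y + v)) / INR (S k) ^ 2) n
      - rsum (fun k => cos (2 * PI * INR (S k) ^ 2 * y) / INR (S k) ^ 2) n)
    <= 44 * M / sqrt (INR K).
Proof.
  intros HK HvK HM0 HM. apply (trig_increment cos (fun x => - sin x)); auto.
  - intros c x. auto_derive; [trivial|ring].
  - intros m x Hm Hx; apply (gauss_abs_le x M m HM0 (HM m x Hm Hx)).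
  - intros x Hx.
    rewrite (rsum_ext _ (fun k => - 1 * sin (2 * PI * INR (S k) ^ 2 * x))) by (intros; ring).
    rewrite rsum_scal, Rabs_mult, (Rabs_left (- 1)) by lra.
    replace (- -1) with 1 by ring. rewrite Rmult_1_l.
    apply (gauss_abs_le x M K HM0 (HM K x (le_n K) Hx)).
Qed.

Lemma sin_increment (y v M : R) (K n : nat) :
  (0 < K)%nat -> Rabs v * INR K ^ 2 <= 4 -> 0 <= M ->
  (forall n x, (K <= n)%nat -> Rabs (x - y) <= Rabs v ->
     gauss_sq x n <= (M * (INR n * sqrt (INR n))) ^ 2) ->
  (K <= n)%nat ->
  Rabs (rsum (fun k => sin (2 * PI * INR (S k) ^ 2 * (y + v)) / INR (S k) ^ 2) n
      - rsum (fun k => sin (2 * PI * INR (S k) ^ 2 * y) / INR (S k) ^ 2) n)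
    <= 44 * M / sqrt (INR K).
Proof.
  intros HK HvK HM0 HM. apply (trig_increment sin cos); auto.
  - intros c x. auto_derive; [trivial|ring].
  - intros m x Hm Hx; apply (gauss_abs_le x M m HM0 (HM m x Hm Hx)).
  - intros x Hx; apply (gauss_abs_le x M K HM0 (HM K x (le_n K) Hx)).
Qed.

(** The terms [k] and [-k] coincide, and [4 PI^2 k^2 t] is [2 PI k^2 y] for [y = 2 PI t], the phase
    of the quadratic sums. *)
Lemma fst_phi_pair (n : nat) (t : R) :
  fst (phi_pair n t) = (1 - cos (2 * PI * INR (S n) ^ 2 * (2 * PI * t))) / INR (S n) ^ 2 * / (2 * PI ^ 2).
Proof.
  assert (Hn : 0 < INR (S n)) by (apply lt_0_INR; lia). pose proof PI_RGT_0.
  unfold phi_pair, phi_term, Cminus, Cplus, Cmult, Copp, RtoC; cbn [fst snd].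
  rewrite opp_IZR, <- INR_IZR_INZ.
  replace (4 * PI ^ 2 * (- INR (S n)) ^ 2) with (4 * PI ^ 2 * INR (S n) ^ 2) by ring.
  replace (4 * PI ^ 2 * INR (S n) ^ 2 * t) with (2 * PI * INR (S n) ^ 2 * (2 * PI * t)) by ring.
  field. lra.
Qed.

Lemma snd_phi_pair (n : nat) (t : R) :
  snd (phi_pair n t) = sin (2 * PI * INR (S n) ^ 2 * (2 * PI * t)) / INR (S n) ^ 2 * / (2 * PI ^ 2).
Proof.
  assert (Hn : 0 < INR (S n)) by (apply lt_0_INR; lia). pose proof PI_RGT_0.
  unfold phi_pair, phi_term, Cminus, Cplus, Cmult, Copp, RtoC; cbn [fst snd].
  rewrite opp_IZR, <- INR_IZR_INZ.
  replace (4 * PI ^ 2 * (- INR (S n)) ^ 2) with (4 * PI ^ 2 * INR (S n) ^ 2) by ring.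
  replace (4 * PI ^ 2 * INR (S n) ^ 2 * t) with (2 * PI * INR (S n) ^ 2 * (2 * PI * t)) by ring.
  field. lra.
Qed.

Lemma ex_series_bounded (a : nat -> R) (B : R) :
  (forall n, 0 <= a n) -> (forall n, rsum a n <= B) -> ex_series a.
Proof.
  intros Ha HB. destruct (ex_finite_lim_seq_incr (sum_n a) B) as [l Hl].
  - intros n. rewrite !sum_n_rsum, (rsum_S a (S n)). specialize (Ha (S n)); lra.
  - intros n; rewrite sum_n_rsum; apply HB.
  - exists l; exact Hl.
Qed.

Lemma ex_series_inv_sq : ex_series (fun n => / INR (S n) ^ 2).
Proof.
  apply ex_series_bounded with 2.
  - intros n; left; apply Rinv_0_lt_compat, pow_lt, lt_0_INR; lia.
  - assert (H : forall n, rsum (fun n => / INR (S n) ^ 2) (S n) <= 2 - / INR (S n)).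
    { induction n as [|n IH]; [simpl; lra|].
      rewrite rsum_S. assert (Hn : 0 < INR (S n)) by (apply lt_0_INR; lia).
      rewrite (S_INR (S n)). set (x := INR (S n)) in *.
      enough (/ (x + 1) ^ 2 <= / x - / (x + 1)) by lra.
      replace (/ x - / (x + 1)) with (/ (x * (x + 1))) by (field; lra).
      apply Rinv_le_contravar; nra. }
    intros [|n]; [simpl; lra|]. eapply Rle_trans; [apply H|].
    assert (0 < / INR (S n)) by (apply Rinv_0_lt_compat, lt_0_INR; lia). lra.
Qed.

Lemma ex_series_quadratic (a : nat -> R) (c B : R) : 0 <= c ->
  (forall n, Rabs (a n) <= B) -> ex_series (fun n => a n / INR (S n) ^ 2 * c).
Proof.
  intros Hc HB.
  apply (ex_series_le (K := R_AbsRing) (V := R_CompleteNormedModule) _ (fun n => (B * c) * / INR (S n) ^ 2)).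
  - intros n. change (Rabs (a n / INR (S n) ^ 2 * c) <= (B * c) * / INR (S n) ^ 2).
    assert (0 < / INR (S n) ^ 2) by (apply Rinv_0_lt_compat, pow_lt, lt_0_INR; lia).
    unfold Rdiv. rewrite !Rabs_mult, (Rabs_pos_eq c), (Rabs_pos_eq (/ _)) by lra.
    specialize (HB n). pose proof (Rabs_pos (a n)).
    assert (0 <= c * / INR (S n) ^ 2) by nra. nra.
  - apply (ex_series_scal_l (K := R_AbsRing) (B * c) (fun n => / INR (S n) ^ 2)), ex_series_inv_sq.
Qed.

Lemma series_diff_le (a b : nat -> R) (B : R) (K : nat) :
  ex_series a -> ex_series b ->
  (forall n, (K <= n)%nat -> Rabs (rsum a n - rsum b n) <= B) ->
  Rabs (Series a - Series b) <= B.
Proof.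
  intros Ha Hb H. rewrite <- Series_minus by assumption.
  assert (L : is_lim_seq (sum_n (fun n => a n - b n)) (Series (fun n => a n - b n))).
  { apply Series_correct, (ex_series_minus (V := R_NormedModule)); assumption. }
  apply is_lim_seq_abs in L.
  apply (is_lim_seq_le_loc _ (fun _ => B) _ B) in L; [exact L| |apply is_lim_seq_const].
  exists K. intros n Hn. rewrite sum_n_rsum.
  replace (rsum (fun n => a n - b n) (S n)) with (rsum a (S n) - rsum b (S n)).
  - apply H; lia.
  - unfold Rminus. rewrite rsum_plus.
    rewrite (rsum_ext (fun k => - b k) (fun k => - 1 * b k)), rsum_scal by (intros; ring). ring.
Qed.

Lemma Cmod_le_sum (z : C) : Cmod z <= Rabs (fst z) + Rabs (snd z).
Proof.
  unfold Cmod. rewrite <- (sqrt_pow2 (Rabs (fst z) + Rabs (snd z))).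
  - apply sqrt_le_1_alt. rewrite <- (pow2_abs (fst z)), <- (pow2_abs (snd z)).
    pose proof (Rabs_pos (fst z)); pose proof (Rabs_pos (snd z)). nra.
  - pose proof (Rabs_pos (fst z)); pose proof (Rabs_pos (snd z)). lra.
Qed.

(** The term [k = 0] moves by [h]. In each coordinate the rest moves by at most [3 M / sqrt K]; the
    constant part of the cosine series cancels. *)
Lemma phi_increment (t h M : R) (K : nat) :
  (0 < K)%nat -> Rabs (2 * PI * h) * INR K ^ 2 <= 4 -> 0 <= M ->
  (forall n x, (K <= n)%nat -> Rabs (x - 2 * PI * t) <= Rabs (2 * PI * h) ->
     gauss_sq x n <= (M * (INR n * sqrt (INR n))) ^ 2) ->
  Cmod (Cminus (phi (t + h)) (phi t)) <= Rabs h + 6 * M / sqrt (INR K).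
Proof.
  intros HK HvK HM0 HM.
  assert (HPI : 3 < PI) by (pose proof PI2_3_2; lra).
  (* As [PI > 3], the factor [c <= 1 / 18] brings 44 below 3. *)
  set (c := / (2 * PI ^ 2)).
  assert (Hc : 0 <= c <= / 18).
  { split; [left; apply Rinv_0_lt_compat; nra|]. apply Rinv_le_contravar; nra. }
  assert (HsK : 0 < sqrt (INR K)) by (apply sqrt_lt_R0, lt_0_INR; lia).
  assert (Hms : 0 <= M / sqrt (INR K)) by (apply Rdiv_le_0_compat; lra).
  assert (HB : c * (44 * M / sqrt (INR K)) <= 3 * M / sqrt (INR K)).
  { unfold Rdiv in *. nra. }
  assert (Ey : 2 * PI * (t + h) = 2 * PI * t + 2 * PI * h) by ring.
  eapply Rle_trans; [apply Cmod_le_sum|].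
  set (f := fun t n => fst (phi_pair n t)). set (g := fun t n => snd (phi_pair n t)).
  assert (exf : forall t, ex_series (f t)).
  { intros s. apply (ex_series_ext (fun n =>
      (1 - cos (2 * PI * INR (S n) ^ 2 * (2 * PI * s))) / INR (S n) ^ 2 * c)).
    - intros n; symmetry; apply fst_phi_pair.
    - apply ex_series_quadratic with 2; [lra|]. intros n.
      pose proof (COS_bound (2 * PI * INR (S n) ^ 2 * (2 * PI * s))). apply Rabs_le; lra. }
  assert (exg : forall t, ex_series (g t)).
  { intros s. apply (ex_series_ext (fun n =>
      sin (2 * PI * INR (S n) ^ 2 * (2 * PI * s)) / INR (S n) ^ 2 * c)).
    - intros n; symmetry; apply snd_phi_pair.
    - apply ex_series_quadratic with 1; [lra|]. intros n. apply Rabs_le, SIN_bound. }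
  assert (B1 : Rabs (Series (f (t + h)) - Series (f t)) <= 3 * M / sqrt (INR K)).
  { apply series_diff_le with K; auto. intros n Hn.
    eapply Rle_trans; [|exact HB].
    assert (Ef : forall s, rsum (f s) n = c * rsum (fun k => / INR (S k) ^ 2) n - c *
       rsum (fun k => cos (2 * PI * INR (S k) ^ 2 * (2 * PI * s)) / INR (S k) ^ 2) n).
    { intros s. unfold Rminus. rewrite <- rsum_scal, Ropp_mult_distr_l, <- rsum_scal, <- rsum_plus.
      apply rsum_ext; intros k _. unfold f; rewrite fst_phi_pair. fold c. unfold Rdiv; ring. }
    rewrite !Ef. match goal with |- Rabs (?a - c * ?x - (?a - c * ?z)) <= _ =>
      replace (a - c * x - (a - c * z)) with (- (c * (x - z))) by ring end.
    rewrite Rabs_Ropp, Rabs_mult, Rabs_pos_eq by lra. apply Rmult_le_compat_l; [lra|].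
    rewrite Ey. apply cos_increment; assumption. }
  assert (B2 : Rabs (Series (g (t + h)) - Series (g t)) <= 3 * M / sqrt (INR K)).
  { apply series_diff_le with K; auto. intros n Hn.
    eapply Rle_trans; [|exact HB].
    assert (Eg : forall s, rsum (g s) n = c *
       rsum (fun k => sin (2 * PI * INR (S k) ^ 2 * (2 * PI * s)) / INR (S k) ^ 2) n).
    { intros s. rewrite <- rsum_scal.
      apply rsum_ext; intros k _. unfold g; rewrite snd_phi_pair. fold c. unfold Rdiv; ring. }
    rewrite !Eg, <- Rmult_minus_distr_l, Rabs_mult, Rabs_pos_eq by lra.
    apply Rmult_le_compat_l; [lra|].
    rewrite Ey. apply sin_increment; assumption. }
  change (Rabs (0 + Series (f (t + h)) + - (0 + Series (f t)))
    + Rabs (t + h + Series (g (t + h)) + - (t + Series (g t))) <= Rabs h + 6 * M / sqrt (INR K)).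
  replace (0 + Series (f (t + h)) + - (0 + Series (f t))) with (Series (f (t + h)) - Series (f t))
    by ring.
  replace (t + h + Series (g (t + h)) + - (t + Series (g t)))
    with (h + (Series (g (t + h)) - Series (g t))) by ring.
  pose proof (Rabs_triang h (Series (g (t + h)) - Series (g t))).
  unfold Rdiv in *. lra.
Qed.

Lemma Rabs_le_2PI (h : R) : Rabs h <= Rabs (2 * PI * h).
Proof.
  assert (3 < PI) by (pose proof PI2_3_2; lra).
  rewrite Rabs_mult, (Rabs_pos_eq (2 * PI)) by lra. pose proof (Rabs_pos h). nra.
Qed.

(** Choose [K] just above [v^(-1/2)], where [v = |2 PI h|]. A bound [M n^(1 + e)] on the quadratic
    sums then becomes [M K^(e - 1) <= M v^((1 - e) / 2)] for the increment. *)
Lemma phi_increment_pow (t h M e : R) :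
  0 <= e <= 1 / 2 -> 0 < Rabs (2 * PI * h) <= 1 -> 0 <= M ->
  (forall n x, 1 <= Rabs (2 * PI * h) * INR n ^ 2 ->
     Rabs (x - 2 * PI * t) <= Rabs (2 * PI * h) ->
     gauss_sq x n <= M ^ 2 * Rpower (INR n) (2 + 2 * e)) ->
  Cmod (Cminus (phi (t + h)) (phi t))
    <= Rabs h + 6 * M * Rpower (Rabs (2 * PI * h)) ((1 - e) / 2).
Proof.
  intros He Hv HM0 HM. set (v := Rabs (2 * PI * h)) in *.
  set (X := Rpower v (- (1 / 2))).
  assert (HX : 1 <= X).
  { rewrite <- (Rpower_1_l (- (1 / 2))) at 1. apply Rpower_neg_base; lra. }
  assert (HX2 : v * X ^ 2 = 1).
  { unfold X. rewrite Rpower_sqr. rewrite <- (Rpower_1 v) at 1 by lra.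
    rewrite <- Rpower_plus. replace (1 + 2 * - (1 / 2)) with 0 by field. apply Rpower_O; lra. }
  destruct (nfloor_ex X ltac:(lra)) as [m [Hm1 Hm2]].
  set (K := S m).
  assert (HKX : X <= INR K <= 2 * X) by (unfold K; rewrite S_INR; lra).
  assert (HK : (0 < K)%nat) by (unfold K; lia).
  (* [n^(1 + e) = n^(3/2) n^(e - 1/2)], and the last factor decreases in [n] because [e <= 1/2], so
     its value at [K] serves for all [n >= K]. *)
  set (M' := M * Rpower (INR K) (e - 1 / 2)).
  assert (HM'0 : 0 <= M') by (apply Rmult_le_pos; [exact HM0|left; apply Rpower_pos]).
  eapply Rle_trans; [apply (phi_increment t h M' K)|]; auto.
  - fold v. assert (INR K ^ 2 <= 4 * X ^ 2) by nra. nra.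
  - intros n x Hn Hx.
    assert (HnK : INR K <= INR n) by (apply le_INR, Hn).
    eapply Rle_trans; [apply HM; [|exact Hx]|].
    + rewrite <- HX2. apply Rmult_le_compat_l; [lra|]. apply pow_incr; lra.
    + rewrite <- (Rpower_sqrt (INR n)) by lra.
      rewrite <- (Rpower_1 (INR n)) at 2 by lra.
      rewrite <- Rpower_plus. unfold M'. rewrite Rmult_assoc, Rpow_mult_distr.
      apply Rmult_le_compat_l; [nra|].
      rewrite Rpow_mult_distr, !Rpower_sqr.
      apply Rle_trans with (Rpower (INR n) (2 * (e - 1 / 2)) * Rpower (INR n) (2 * (1 + / 2))).
      * rewrite <- Rpower_plus. right; f_equal; field.
      * apply Rmult_le_compat_r; [left; apply Rpower_pos|].
        apply Rpower_neg_base; lra.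
  - apply Rplus_le_compat_l. unfold M'.
    rewrite <- (Rpower_sqrt (INR K)) by lra. unfold Rdiv. rewrite <- Rpower_Ropp.
    rewrite !Rmult_assoc, <- Rpower_plus.
    apply Rmult_le_compat_l; [lra|]. apply Rmult_le_compat_l; [lra|].
    apply Rle_trans with (Rpower X (e - 1 * / 2 + - / 2)).
    + apply Rpower_neg_base; lra.
    + unfold X. rewrite Rpower_mult. right; f_equal; field.
Qed.

(** Every [x] within [rho <= 1 / q^2] of [p / q] satisfies Weyl's condition with this same [q], and
    the relevant [n] are at least [q], so [n^2 / q] dominates. Stating the bound with the radius
    [rho] makes it uniform on the neighbourhood. *)
Lemma phi_near_rational (e : R) : 0 < e <= 1 / 2 ->
  exists C0, 0 < C0 /\ forall (p : Z) (q : nat) (t0 t rho : R),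
    (0 < q)%nat -> Z.gcd p (Z.of_nat q) = 1%Z -> 2 * PI * t0 = IZR p / INR q ->
    Rabs (2 * PI * t - IZR p / INR q) <= rho -> 0 < rho <= / INR q ^ 2 ->
    Cmod (Cminus (phi t) (phi t0))
      <= C0 * Rpower (INR q) (- (1 / 2)) * Rpower rho ((1 - e) / 2).
Proof.
  intros He.
  (* Weyl's constant 24 times 3, as each of the three terms is at most [n^2 / q]. The loss is
     [q^(2 e)], to fit the exponent [2 + 2 * e] of [phi_increment_pow]. *)
  set (A := 72 * (1 + / (2 * e))).
  assert (HA : 0 < A).
  { unfold A. assert (0 < / (2 * e)) by (apply Rinv_0_lt_compat; lra). lra. }
  exists (1 + 6 * sqrt A). split; [pose proof (sqrt_pos A); lra|].
  intros p q t0 t rho Hq Hg Ht0 Ht Hrho.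
  assert (Hq1 : 1 <= INR q) by (apply (le_INR 1); lia).
  assert (Hqi : 0 < / INR q ^ 2 <= 1).
  { split; [apply Rinv_0_lt_compat; nra|]. rewrite <- Rinv_1. apply Rinv_le_contravar; nra. }
  set (h := t - t0). replace t with (t0 + h) by (unfold h; ring).
  assert (Ev : 2 * PI * t - IZR p / INR q = 2 * PI * h) by (unfold h; rewrite <- Ht0; ring).
  rewrite Ev in Ht.
  pose proof (Rpower_pos (INR q) (- (1 / 2))) as P1.
  pose proof (Rpower_pos rho ((1 - e) / 2)) as P2.
  destruct (Req_dec (2 * PI * h) 0) as [H0|H0].
  { assert (h = 0) by (pose proof PI_RGT_0; apply Rmult_integral in H0; destruct H0; lra).
    rewrite H, Rplus_0_r. unfold Cminus. rewrite Cplus_opp_r, Cmod_0.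
    pose proof (sqrt_pos A). apply Rmult_le_pos; [apply Rmult_le_pos|]; lra. }
  assert (Hv : 0 < Rabs (2 * PI * h) <= 1) by (split; [now apply Rabs_pos_lt|lra]).
  set (v := Rabs (2 * PI * h)) in *.
  set (M := sqrt A * Rpower (INR q) (- (1 / 2))).
  assert (HM0 : 0 <= M) by (apply Rmult_le_pos; [apply sqrt_pos|lra]).
  assert (HM2 : M ^ 2 = A / INR q).
  { unfold M. rewrite Rpow_mult_distr, pow2_sqrt, Rpower_sqr by lra.
    replace (2 * - (1 / 2)) with (- (1)) by field. rewrite Rpower_Ropp, Rpower_1 by lra. reflexivity. }
  eapply Rle_trans; [apply (phi_increment_pow t0 h M e); fold v; auto; try lra|].
  - intros n x Hn Hx.
    assert (Hnq : INR q <= INR n).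
    { assert (INR q ^ 2 <= INR n ^ 2).
      { assert (v * INR n ^ 2 <= / INR q ^ 2 * INR n ^ 2) by (apply Rmult_le_compat_r; nra).
        assert (H1 : 1 <= / INR q ^ 2 * INR n ^ 2) by lra.
        apply Rmult_le_compat_l with (r := INR q ^ 2) in H1; [|nra].
        rewrite <- Rmult_assoc, Rinv_r in H1 by nra. lra. }
      pose proof (pos_INR n). nra. }
    assert (Hn0 : (0 < n)%nat) by (apply INR_lt; simpl; lra).
    eapply Rle_trans; [apply (weyl_bound_pow (2 * e) x p q n); auto; try lra|].
    { rewrite <- Ht0. lra. }
    rewrite HM2.
    set (Z := INR n ^ 2 / INR q).
    assert (HZ1 : INR n <= Z).
    { unfold Z. apply Rmult_le_reg_r with (INR q); [lra|].
      replace (INR n ^ 2 / INR q * INR q) with (INR n ^ 2) by (field; lra). nra. }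
    rewrite Rpower_plus.
    replace (Rpower (INR n) 2) with (INR n ^ 2).
    2: { rewrite <- (Rpower_pow 2) by lra. reflexivity. }
    replace (A / INR q * (INR n ^ 2 * Rpower (INR n) (2 * e)))
      with (24 * (1 + / (2 * e)) * Rpower (INR n) (2 * e) * (3 * Z))
      by (unfold A, Z; field; lra).
    assert (0 < / (2 * e)) by (apply Rinv_0_lt_compat; lra).
    apply Rmult_le_compat.
    + pose proof (Rpower_pos (INR q) (2 * e)). apply Rmult_le_pos; lra.
    + lra.
    + apply Rmult_le_compat_l; [lra|]. apply Rpower_le_base; lra.
    + lra.
  (* The linear term is absorbed: [|h| <= rho = rho^(1/2) rho^(1/2)], and one factor is at most
     [1 / q]. *)
  - fold v. assert (B1 : Rabs h <= Rpower (INR q) (- (1 / 2)) * Rpower rho ((1 - e) / 2)).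
    { apply Rle_trans with (Rpower rho (1 / 2) * Rpower rho (1 / 2)).
      - rewrite <- Rpower_plus. replace (1 / 2 + 1 / 2) with 1 by field.
        rewrite Rpower_1 by lra. pose proof (Rabs_le_2PI h). fold v in H. lra.
      - apply Rmult_le_compat; try (left; apply Rpower_pos).
        + apply Rle_trans with (Rpower (/ INR q ^ 2) (1 / 2)); [apply Rpower_le_base; lra|].
          rewrite <- (Rpower_pow 2), <- Rpower_Ropp, Rpower_mult by lra. simpl (INR 2).
          apply Rle_Rpower; lra.
        + apply Rpower_antitone; lra. }
    assert (B2 : M * Rpower v ((1 - e) / 2)
      <= sqrt A * (Rpower (INR q) (- (1 / 2)) * Rpower rho ((1 - e) / 2))).
    { unfold M. rewrite Rmult_assoc. apply Rmult_le_compat_l; [apply sqrt_pos|].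
      apply Rmult_le_compat_l; [lra|]. apply Rpower_le_base; lra. }
    lra.
Qed.

(* Dirichlet's theorem at the scale [X = n^2 H^(1/mu)]: both Weyl terms [n^2 / q] and [q]
   are then at most of the order of [X]. *)
Lemma gauss_sq_diophantine (x0 c mu e H x : R) (n : nat) :
  0 < c <= 1 -> 2 <= mu -> 0 < e ->
  (forall (p : Z) (q : nat), (0 < q)%nat -> Z.gcd p (Z.of_nat q) = 1%Z ->
     c * Rpower (INR q) (- mu) <= Rabs (x0 - IZR p / INR q)) ->
  0 < H <= 1 -> 1 <= H * INR n ^ 2 -> Rabs (x - x0) <= H ->
  gauss_sq x n
    <= 24 * (1 + / e) * (2 / c + 2) * Rpower H (/ mu) * Rpower (INR n) (2 + 2 * e).
Proof.
  intros Hc Hmu He Hdio HH HHn Hx.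
  assert (Himu : 0 < / mu <= / 2).
  { split; [apply Rinv_0_lt_compat; lra|]. apply Rinv_le_contravar; lra. }
  assert (Hn0 : (0 < n)%nat).
  { destruct n; [simpl in HHn; lra|lia]. }
  assert (Hn : 1 <= INR n) by (apply (le_INR 1); lia).
  set (G := Rpower H (/ mu)).
  assert (HG0 : 0 < G) by apply Rpower_pos.
  assert (HG1 : G <= 1) by (apply Rpower_le1; lra).
  set (X := INR n ^ 2 * G).
  (* [n H^(1/2) >= 1] and [mu >= 2] give [n G >= 1]; thus [X >= 1], and the middle Weyl term is at
     most [X]. *)
  assert (HnX : INR n <= X).
  { assert (Hs : 1 <= INR n * Rpower H (/ 2)).
    { rewrite Rpower_sqrt by lra.
      assert (sqrt H * sqrt H = H) by (apply sqrt_sqrt; lra).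
      assert (0 < sqrt H) by (apply sqrt_lt_R0; lra).
      apply Rnot_lt_le; intros Hlt.
      assert (0 < INR n * sqrt H) by nra.
      assert (INR n * sqrt H * (INR n * sqrt H) < 1) by nra.
      replace (INR n * sqrt H * (INR n * sqrt H)) with (INR n ^ 2 * (sqrt H * sqrt H)) in H3 by ring.
      rewrite H0 in H3. lra. }
    assert (Rpower H (/ 2) <= G) by (apply Rpower_antitone; lra).
    unfold X. assert (1 <= INR n * G) by nra. nra. }
  destruct (dirichlet x X ltac:(lra)) as (p & qz & Hqz & Hg & HqX & Hapx).
  set (q := Z.to_nat qz).
  assert (Eq : Z.of_nat q = qz) by (unfold q; apply Z2Nat.id; lia).
  assert (Hq : (0 < q)%nat) by (unfold q; lia).
  assert (EqR : IZR qz = INR q) by (rewrite INR_IZR_INZ, Eq; reflexivity).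
  rewrite EqR in *. rewrite <- Eq in Hg.
  assert (Hq1 : 1 <= INR q) by (apply (le_INR 1); lia).
  assert (Hqi : / INR q <= 2 / c * G).
  { assert (H2c : 1 <= 2 / c).
    { apply Rmult_le_reg_r with c; [lra|]. unfold Rdiv; rewrite Rmult_assoc, Rinv_l; lra. }
    assert (H1 : c * Rpower (INR q) (- mu) <= H + / (INR q * X)).
    { eapply Rle_trans; [apply (Hdio p q Hq Hg)|].
      replace (x0 - IZR p / INR q) with (- (x - x0) + (x - IZR p / INR q)) by ring.
      eapply Rle_trans; [apply Rabs_triang|]. rewrite Rabs_Ropp. lra. }
    (* Either the displacement [H] dominates, and [q^(-mu) << H]; or the Dirichlet error does, and
       [q^(-(mu - 1)) << 1 / X <= H^(1 - 1/mu)]. Taking roots, both yield [1 / q << H^(1/mu)]. *)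
    destruct (Rle_lt_dec (/ (INR q * X)) H) as [Hcase|Hcase].
    - assert (H2 : Rpower (INR q) (- mu) <= 2 / c * H).
      { apply Rmult_le_reg_l with c; [lra|].
        replace (c * (2 / c * H)) with (2 * H) by (field; lra). lra. }
      rewrite <- (Rpower_1 (INR q)) at 1 by lra.
      rewrite <- Rpower_Ropp.
      replace (- (1)) with (- mu * / mu) by (field; lra).
      rewrite <- Rpower_mult.
      eapply Rle_trans; [apply Rpower_le_base; [lra|split; [apply Rpower_pos|apply H2]]|].
      rewrite <- Rpower_mult_distr by lra.
      apply Rmult_le_compat_r; [lra|].
      rewrite <- (Rpower_1 (2 / c)) at 2 by lra. apply Rle_Rpower; lra.
    - assert (H2 : Rpower (INR q) (- (mu - 1)) <= 2 / c * / X).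
      { apply Rmult_le_reg_l with (c * / INR q).
        - apply Rmult_lt_0_compat; [lra|apply Rinv_0_lt_compat; lra].
        - replace (c * / INR q * (2 / c * / X)) with (2 * / (INR q * X)) by (field; lra).
          replace (c * / INR q * Rpower (INR q) (- (mu - 1))) with (c * Rpower (INR q) (- mu)).
          + lra.
          + replace (- mu) with (- (1) + - (mu - 1)) by ring.
            rewrite Rpower_plus, (Rpower_Ropp _ 1), Rpower_1 by lra. ring. }
      assert (H3 : / X <= Rpower H (1 - / mu)).
      { unfold Rminus. rewrite Rpower_plus, Rpower_1, Rpower_Ropp by lra. fold G.
        unfold X. rewrite Rinv_mult. apply Rmult_le_compat_r.
        - left; apply Rinv_0_lt_compat; lra.
        - apply Rmult_le_reg_r with (INR n ^ 2); [nra|]. rewrite Rinv_l by nra. lra. }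
      assert (H4 : Rpower (INR q) (- (mu - 1)) <= 2 / c * Rpower H (1 - / mu)).
      { eapply Rle_trans; [apply H2|]. apply Rmult_le_compat_l; lra. }
      assert (Hm1 : 0 < / (mu - 1) <= 1).
      { split; [apply Rinv_0_lt_compat; lra|]. rewrite <- Rinv_1; apply Rinv_le_contravar; lra. }
      rewrite <- (Rpower_1 (INR q)) at 1 by lra.
      rewrite <- Rpower_Ropp.
      replace (- (1)) with (- (mu - 1) * / (mu - 1)) by (field; lra).
      rewrite <- Rpower_mult.
      eapply Rle_trans; [apply Rpower_le_base; [lra|split; [apply Rpower_pos|apply H4]]|].
      rewrite <- Rpower_mult_distr by (try apply Rpower_pos; lra).
      apply Rmult_le_compat; try (left; apply Rpower_pos).
      + rewrite <- (Rpower_1 (2 / c)) at 2 by lra. apply Rle_Rpower; lra.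
      + rewrite Rpower_mult. unfold G. right; f_equal. field; lra. }
  eapply Rle_trans; [apply (weyl_bound_pow e x p q n); auto|].
  { eapply Rle_trans; [apply Hapx|]. apply Rinv_le_contravar; nra. }
  assert (Hie : 0 < / e) by (apply Rinv_0_lt_compat; lra).
  assert (E2 : INR n ^ 2 / INR q <= 2 / c * X).
  { unfold X, Rdiv in *. assert (0 < INR n ^ 2) by nra. nra. }
  (* Since [G <= 1], the denominator satisfies [q <= X <= n^2]. *)
  assert (Eq2 : Rpower (INR q) e <= Rpower (INR n) (2 * e)).
  { apply Rle_trans with (Rpower (INR n ^ 2) e).
    - apply Rpower_le_base; [lra|]. split; [lra|]. unfold X in HqX.
      assert (0 < INR n ^ 2) by nra. nra.
    - rewrite <- (Rpower_pow 2), Rpower_mult by lra. simpl (INR 2). right; f_equal; ring. }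
  rewrite Rpower_plus.
  replace (Rpower (INR n) 2) with (INR n ^ 2)
    by (rewrite <- (Rpower_pow 2) by lra; reflexivity).
  replace (24 * (1 + / e) * (2 / c + 2) * G * (INR n ^ 2 * Rpower (INR n) (2 * e)))
    with (24 * (1 + / e) * Rpower (INR n) (2 * e) * ((2 / c + 2) * X)) by (unfold X; ring).
  assert (0 < INR n ^ 2 / INR q) by (apply Rdiv_lt_0_compat; nra).
  apply Rmult_le_compat.
  - pose proof (Rpower_pos (INR q) e). apply Rmult_le_pos; lra.
  - lra.
  - apply Rmult_le_compat_l; lra.
  - lra.
Qed.

(** [gauss_sq_diophantine] at [H = v] permits [M] of order [v^(1 / (2 mu))] in [phi_increment_pow],
    which adds [1 / (2 mu)] to the exponent [(1 - e) / 2]. *)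
Lemma phi_diophantine (t c mu e : R) :
  0 < c <= 1 -> 2 <= mu -> 0 < e <= 1 / 2 ->
  (forall (p : Z) (q : nat), (0 < q)%nat -> Z.gcd p (Z.of_nat q) = 1%Z ->
     c * Rpower (INR q) (- mu) <= Rabs (2 * PI * t - IZR p / INR q)) ->
  exists C0, 0 < C0 /\ forall h, 0 < Rabs (2 * PI * h) <= 1 ->
    Cmod (Cminus (phi (t + h)) (phi t))
      <= C0 * Rpower (Rabs (2 * PI * h)) (1 / 2 + / (2 * mu) - e / 2).
Proof.
  intros Hc Hmu He Hdio.
  set (A := 24 * (1 + / e) * (2 / c + 2)).
  assert (HA : 0 <= A).
  { unfold A. assert (0 < / e) by (apply Rinv_0_lt_compat; lra).
    assert (0 < 2 / c) by (apply Rdiv_lt_0_compat; lra). nra. }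
  exists (1 + 6 * sqrt A). split; [pose proof (sqrt_pos A); lra|].
  intros h Hv. set (v := Rabs (2 * PI * h)) in *.
  assert (Himu : 0 < / (2 * mu) <= / 4).
  { split; [apply Rinv_0_lt_compat; lra|]. apply Rinv_le_contravar; lra. }
  set (M := sqrt A * Rpower v (/ (2 * mu))).
  eapply Rle_trans; [apply (phi_increment_pow t h M e); fold v; try lra|].
  - apply Rmult_le_pos; [apply sqrt_pos|left; apply Rpower_pos].
  - intros n x Hn Hx.
    eapply Rle_trans; [apply (gauss_sq_diophantine (2 * PI * t) c mu e v x n); auto; lra|].
    right. unfold M. rewrite Rpow_mult_distr, pow2_sqrt, Rpower_sqr by lra.
    replace (2 * / (2 * mu)) with (/ mu) by (field; lra). reflexivity.
  - fold v. assert (B1 : Rabs h <= Rpower v (1 / 2 + / (2 * mu) - e / 2)).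
    { apply Rle_trans with v; [apply Rabs_le_2PI|].
      rewrite <- (Rpower_1 v) at 1 by lra. apply Rpower_antitone; lra. }
    assert (B2 : M * Rpower v ((1 - e) / 2) = sqrt A * Rpower v (1 / 2 + / (2 * mu) - e / 2)).
    { unfold M. rewrite Rmult_assoc, <- Rpower_plus. f_equal; f_equal; field; lra. }
    lra.
Qed.

(** * Hausdorff null sets *)

Lemma rpow_pos_eq (x b : R) : 0 < x -> rpow x b = Rpower x b.
Proof. intros Hx; unfold rpow; destruct (Rlt_dec 0 x); [reflexivity|contradiction]. Qed.

Lemma rpow_0_l (b : R) : 0 < b -> rpow 0 b = 0.
Proof.
  intros Hb; unfold rpow. destruct (Rlt_dec 0 0); [lra|].
  destruct (Req_EM_T b 0); [lra|reflexivity].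
Qed.

Lemma rpow_ge0 (x b : R) : 0 <= rpow x b.
Proof.
  unfold rpow. destruct (Rlt_dec 0 x); [left; apply Rpower_pos|].
  destruct (Req_EM_T b 0); lra.
Qed.

Lemma diam_pow_ge0 (U : C -> Prop) (s : R) : 0 <= diam_pow U s.
Proof. unfold diam_pow; destruct Rlt_dec; [left; apply Rpower_pos|lra]. Qed.

Lemma diam_le (U : C -> Prop) (d : R) : 0 <= d -> bounded_by U d -> diam U <= d.
Proof.
  intros Hd HU. unfold diam.
  match goal with |- real (Lub_Rbar ?E) <= d => destruct (Lub_Rbar_correct E) as [_ H]; set (l := Lub_Rbar E) in * end.
  specialize (H (Finite d)).
  assert (Hl : Rbar_le l d).
  { apply H. intros r [-> | (x & y & Hx & Hy & ->)]; simpl; [exact Hd|now apply HU]. }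
  destruct l; simpl in *; try contradiction; assumption.
Qed.

Lemma diam_pow_le (U : C -> Prop) (d s : R) : 0 < s -> 0 <= d -> bounded_by U d ->
  diam_pow U s <= rpow d s.
Proof.
  intros Hs Hd HU. pose proof (diam_le U d Hd HU). unfold diam_pow.
  destruct Rlt_dec as [H0|H0]; [|apply rpow_ge0].
  rewrite rpow_pos_eq by lra. apply Rpower_le_base; lra.
Qed.

(** Any bounds [d i] on the diameters and bounded partial sums suffice, so covers are handled with
    neither suprema nor convergence; the mesh is left free. *)
Definition covered (s E : R) (A : C -> Prop) : Prop :=
  exists (U : nat -> C -> Prop) (d : nat -> R),
    (forall i, 0 <= d i) /\ (forall i, bounded_by (U i) (d i)) /\
    (forall z, A z -> exists i, U i z) /\
    (forall n, rsum (fun i => rpow (d i) s) n <= E).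

Definition null (s : R) (A : C -> Prop) : Prop := forall E, 0 < E -> covered s E A.

Lemma covered_double (s E : R) (A : C -> Prop) (U : nat -> nat -> C -> Prop)
    (d : nat -> nat -> R) (g : nat -> R) :
  (forall i j, 0 <= d i j) -> (forall i j, bounded_by (U i j) (d i j)) ->
  (forall z, A z -> exists i j, U i j z) ->
  (forall i n, rsum (fun j => rpow (d i j) s) n <= g i) ->
  (forall n, rsum g n <= E) -> covered s E A.
Proof.
  intros Hd HU HA Hg HE.
  exists (fun n => U (fst (Cantor.of_nat n)) (snd (Cantor.of_nat n))),
    (fun n => d (fst (Cantor.of_nat n)) (snd (Cantor.of_nat n))).
  repeat split; auto.
  - intros z Hz; destruct (HA z Hz) as (i & j & H).
    exists (Cantor.to_nat (i, j)). rewrite Cantor.cancel_of_to; exact H.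
  - apply (double_sum_bound (fun i j => rpow (d i j) s) g E); auto.
    intros; apply rpow_ge0.
Qed.

Lemma null_incl (s : R) (A B : C -> Prop) : (forall z, A z -> B z) -> null s B -> null s A.
Proof.
  intros H HB E HE. destruct (HB E HE) as (U & d & H1 & H2 & H3 & H4).
  exists U, d; repeat split; auto.
Qed.

Lemma null_union (s : R) (A : nat -> C -> Prop) :
  (forall i, null s (A i)) -> null s (fun z => exists i, A i z).
Proof.
  intros HA E HE.
  (* The [i]-th set receives the budget [E / 2^(i + 1)]. *)
  set (g := fun i : nat => E * (1 / 2) ^ S i).
  assert (Hg : forall i, 0 < g i).
  { intros i; apply Rmult_lt_0_compat; [exact HE|apply pow_lt; lra]. }
  assert (Hch : exists Ud : nat -> (nat -> C -> Prop) * (nat -> R), forall i,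
    (forall j, 0 <= snd (Ud i) j) /\ (forall j, bounded_by (fst (Ud i) j) (snd (Ud i) j)) /\
    (forall z, A i z -> exists j, fst (Ud i) j z) /\
    (forall n, rsum (fun j => rpow (snd (Ud i) j) s) n <= g i)).
  { apply functional_choice with (R := fun i Ud =>
      (forall j, 0 <= snd Ud j) /\ (forall j, bounded_by (fst Ud j) (snd Ud j)) /\
      (forall z, A i z -> exists j, fst Ud j z) /\
      (forall n, rsum (fun j => rpow (snd Ud j) s) n <= g i)).
    intros i. destruct (HA i (g i) (Hg i)) as (U & d & H). exists (U, d); exact H. }
  destruct Hch as [Ud HUd].
  apply (covered_double s E _ (fun i j => fst (Ud i) j) (fun i j => snd (Ud i) j) g).
  - intros i; apply HUd.
  - intros i; apply HUd.
  - intros z [i Hi]; exists i; apply HUd, Hi.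
  - intros i; apply HUd.
  - intros n. unfold g. rewrite rsum_scal.
    enough (rsum (fun i => (1 / 2) ^ S i) n <= 1) by nra.
    assert (H : rsum (fun i => (1 / 2) ^ S i) n = 1 - (1 / 2) ^ n).
    { induction n as [|n IH]; [simpl; ring|]. rewrite rsum_S, IH. simpl; field. }
    rewrite H. assert (0 < (1 / 2) ^ n) by (apply pow_lt; lra). lra.
Qed.

Lemma null_or (s : R) (A B : C -> Prop) : null s A -> null s B -> null s (fun z => A z \/ B z).
Proof.
  intros HA HB.
  apply null_incl with (fun z => exists i : nat, (match i with O => A | _ => B end) z).
  - intros z [H|H]; [exists 0%nat|exists 1%nat]; exact H.
  - apply null_union. intros [|i]; assumption.
Qed.

Lemma null_point (s : R) (A : C -> Prop) : 0 < s -> bounded_by A 0 -> null s A.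
Proof.
  intros Hs HA E HE. exists (fun _ => A), (fun _ => 0). split; [|split; [|split]].
  - intros; lra.
  - intros; exact HA.
  - intros z Hz; exists 0%nat; exact Hz.
  - intros n. rewrite rsum_const, rpow_0_l by exact Hs. lra.
Qed.

Lemma hausdorff_pre_ge0 (s delta : R) (A : C -> Prop) : Rbar_le 0 (hausdorff_pre s delta A).
Proof.
  unfold hausdorff_pre. apply Glb_Rbar_correct. intros r (U & _ & _ & H). simpl.
  apply (is_lim_seq_le (fun _ => 0) (sum_n (fun i => diam_pow (U i) s)) 0 r).
  - intros n; rewrite sum_n_rsum. apply rsum_nonneg; intros; apply diam_pow_ge0.
  - apply is_lim_seq_const.
  - exact H.
Qed.

Lemma hausdorff_measure_eq0 (s : R) (A : C -> Prop) :
  (forall n : nat, Rbar_le (hausdorff_pre s (/ INR (S n)) A) 0) -> hausdorff_measure s A = Finite 0.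
Proof.
  intros H. unfold hausdorff_measure.
  rewrite (Sup_seq_ext _ (fun _ => Finite 0)).
  - apply is_sup_seq_unique. intros eps; split.
    + intros n; simpl; destruct eps as [e He]; simpl; lra.
    + exists 0%nat; simpl; destruct eps as [e He]; simpl; lra.
  - intros n; apply Rbar_le_antisym; [apply H|apply hausdorff_pre_ge0].
Qed.

(** A cover whose total is at most [delta^s] has each single term at most [delta^s], so its mesh is
    automatically at most [delta]. Hence the minimum of [E] and [delta^s] as budget. *)
Lemma null_hausdorff_measure (s : R) (A : C -> Prop) : 0 < s -> null s A ->
  hausdorff_measure s A = Finite 0.
Proof.
  intros Hs HA. apply hausdorff_measure_eq0. intros n.
  set (delta := / INR (S n)).
  assert (Hdelta : 0 < delta) by (apply Rinv_0_lt_compat, lt_0_INR; lia).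
  assert (H : forall E, 0 < E -> Rbar_le (hausdorff_pre s delta A) E).
  { intros E HE.
    assert (Hm : 0 < Rmin E (Rpower delta s)) by (apply Rmin_pos; [exact HE|apply Rpower_pos]).
    destruct (HA _ Hm) as (U & d & Hd & HU & Hcov & Hsum).
    assert (Hex : ex_series (fun i => diam_pow (U i) s)).
    { apply ex_series_bounded with (Rmin E (Rpower delta s)).
      - intros; apply diam_pow_ge0.
      - intros k; eapply Rle_trans; [|apply (Hsum k)]. apply rsum_le; intros i _.
        now apply diam_pow_le. }
    destruct Hex as [r Hr].
    apply Rbar_le_trans with (Finite r).
    - unfold hausdorff_pre. apply Glb_Rbar_correct. exists U. split; [|split; [exact Hcov|exact Hr]].
      intros i x y Hx Hy. eapply Rle_trans; [apply (HU i x y Hx Hy)|].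
      apply Rnot_lt_le; intros Hlt.
      assert (Hi : rpow (d i) s <= Rpower delta s).
      { eapply Rle_trans; [|apply Rmin_r with (x := E)]. eapply Rle_trans; [|apply (Hsum (S i))].
        rewrite rsum_S.
        pose proof (rsum_nonneg (fun i => rpow (d i) s) i (fun k => rpow_ge0 (d k) s)). lra. }
      rewrite rpow_pos_eq in Hi by lra.
      assert (Rpower delta s < Rpower (d i) s); [|lra].
      unfold Rpower; apply exp_increasing, Rmult_lt_compat_l; [exact Hs|].
      apply ln_increasing; lra.
    - simpl. apply (is_lim_seq_le (sum_n (fun i => diam_pow (U i) s)) (fun _ => E) r E).
      + intros k. rewrite sum_n_rsum. eapply Rle_trans; [|apply Rmin_l with (y := Rpower delta s)].
        eapply Rle_trans; [|apply (Hsum (S k))]. apply rsum_le; intros i _.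
        now apply diam_pow_le.
      + exact Hr.
      + apply is_lim_seq_const. }
  destruct (hausdorff_pre s delta A) as [l| |]; simpl in *.
  - apply Rnot_lt_le; intros Hl. specialize (H (l / 2) ltac:(lra)). lra.
  - apply (H 1); lra.
  - trivial.
Qed.

(** Covers of [B] cover [A], so each exponent admissible for [B] is admissible for [A]. *)
Lemma hausdorff_dim_incl (A B : C -> Prop) : (forall z, A z -> B z) ->
  Rbar_le (hausdorff_dim A) (hausdorff_dim B).
Proof.
  intros HAB. unfold hausdorff_dim.
  apply Glb_Rbar_correct. intros s [Hs HB].
  apply Glb_Rbar_correct. split; [exact Hs|].
  apply hausdorff_measure_eq0. intros n.
  apply Rbar_le_trans with (hausdorff_pre s (/ INR (S n)) B).
  - apply Glb_Rbar_correct. intros r (U & H1 & H2 & H3).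
    apply Glb_Rbar_correct. exists U; auto.
  - rewrite <- HB. unfold hausdorff_measure.
    apply (is_sup_seq_major (fun n => hausdorff_pre s (/ INR (S n)) B)), Sup_seq_correct.
Qed.

Lemma hausdorff_dim_le (A : C -> Prop) (b : R) : 0 <= b ->
  (forall s, b < s -> null s A) -> Rbar_le (hausdorff_dim A) b.
Proof.
  intros Hb H.
  assert (H' : forall s, b < s -> Rbar_le (hausdorff_dim A) s).
  { intros s Hs. apply Glb_Rbar_correct. split; [lra|].
    apply null_hausdorff_measure; [lra|auto]. }
  destruct (hausdorff_dim A) as [l| |]; simpl in *; [|apply (H' (b + 1)); lra|trivial].
  apply Rnot_lt_le; intros Hl. specialize (H' ((l + b) / 2) ltac:(lra)). lra.
Qed.

(** * Diophantine approximation and the covering of the image *)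

(** The limsup set of the Jarnik-Besicovitch theorem in the variable [y = 2 PI t]; arbitrarily large
    denominators stand for infinitely many fractions. *)
Definition well_approximable (mu t : R) : Prop :=
  forall Q : nat, exists (p : Z) (q : nat), (Q <= q)%nat /\ (0 < q)%nat /\
    Z.gcd p (Z.of_nat q) = 1%Z /\ Rabs (2 * PI * t - IZR p / INR q) <= Rpower (INR q) (- mu).

Definition rational_point (t : R) : Prop :=
  exists (p : Z) (q : nat), (0 < q)%nat /\ 2 * PI * t = IZR p / INR q.

(** Turns a union over integers into unions over two natural indices, to which [null_union]
    applies. *)
Lemma Z_diff_nat (m : Z) : exists i j : nat, m = (Z.of_nat i - Z.of_nat j)%Z.
Proof. exists (Z.to_nat m), (Z.to_nat (- m)); lia. Qed.

Lemma null_rational (s : R) : 0 < s -> null s (image phi rational_point).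
Proof.
  intros Hs.
  apply null_incl with (fun z => exists i j k : nat,
    exists t, 2 * PI * t = IZR (Z.of_nat i - Z.of_nat j) / INR (S k) /\ phi t = z).
  - intros z (t & (p & q & Hq & Ht) & Hz).
    destruct (Z_diff_nat p) as (i & j & ->). destruct q as [|k]; [lia|].
    exists i, j, k, t; auto.
  - apply null_union; intros i. apply null_union; intros j. apply null_union; intros k.
    apply null_point; [exact Hs|].
    intros x y (t & Ht & <-) (t' & Ht' & <-).
    assert (t = t').
    { pose proof PI_RGT_0. apply Rmult_eq_reg_l with (2 * PI); [congruence|lra]. }
    subst; unfold Cminus; rewrite Cplus_opp_r, Cmod_0; lra.
Qed.

Lemma rsum_cutoff (D : R) (m n : nat) : 0 <= D ->
  rsum (fun i => if lt_dec i m then D else 0) n <= INR m * D.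
Proof.
  intros HD.
  assert (H : forall n, (n <= m)%nat -> rsum (fun i => if lt_dec i m then D else 0) n = INR n * D).
  { intros k Hk. rewrite <- rsum_const. apply rsum_ext; intros i Hi.
    destruct (lt_dec i m); [reflexivity|lia]. }
  destruct (le_lt_dec n m) as [Hn|Hn].
  - rewrite H by exact Hn. apply Rmult_le_compat_r; [exact HD|apply le_INR, Hn].
  - replace n with (m + (n - m))%nat by lia. rewrite rsum_add, H by lia.
    rewrite (rsum_ext _ (fun _ => 0)), rsum_const; [lra|].
    intros k _. destruct (lt_dec (m + k) m); [lia|reflexivity].
Qed.

(** For every large [Q] the neighbourhoods of the reduced fractions with denominator [q > Q] cover.
    About [q] images of size [q^(-(1 + mu)/2 + mu e/2)] contribute [q^(-1 - tau)] in all, a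
    convergent series whose tail is small. *)
Lemma null_well_approximable_unit (s mu : R) (m : Z) :
  0 < s -> 2 <= mu -> 4 / (1 + mu) < s ->
  null s (image phi (fun t => well_approximable mu t /\ Int_part (2 * PI * t) = m)).
Proof.
  intros Hs Hmu Hsmu E HE.
  assert (Hsm : 4 < s * (1 + mu)).
  { apply Rmult_lt_compat_r with (r := 1 + mu) in Hsmu; [|lra].
    unfold Rdiv in Hsmu; rewrite Rmult_assoc, Rinv_l in Hsmu; lra. }
  (* The loss [s mu e / 2] uses at most half of the margin [s (1 + mu) / 2 - 2], so [tau] is
     positive. *)
  set (e := Rmin (1 / 2) ((s * (1 + mu) / 2 - 2) / (s * mu))).
  assert (Hsmu0 : 0 < s * mu) by nra.
  assert (He : 0 < e <= 1 / 2).
  { unfold e; split; [|apply Rmin_l]. apply Rmin_pos; [lra|]. apply Rdiv_lt_0_compat; lra. }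
  assert (He2 : s * mu * e <= s * (1 + mu) / 2 - 2).
  { apply Rle_trans with (s * mu * ((s * (1 + mu) / 2 - 2) / (s * mu))).
    - apply Rmult_le_compat_l; [lra|apply Rmin_r].
    - right; field; lra. }
  set (tau := s * ((1 + mu) / 2 - mu * e / 2) - 2).
  assert (Htau : 0 < tau) by (unfold tau; lra).
  destruct (phi_near_rational e He) as (C0 & HC0 & Hphi).
  set (B := Rpower (2 * C0) s). assert (HB : 0 < B) by apply Rpower_pos.
  destruct (power_tail_small tau (E / (4 * B)) Htau) as (Q & HQ & Htail).
  { apply Rdiv_lt_0_compat; lra. }
  set (q := fun k : nat => (Q + S k)%nat).
  (* If [m <= y < m + 1] and [|y q - p| <= 1], then [p] lies between [m q - 1] and [m q + q + 1]: at
     most [q + 3] numerators, counted by [i]. *)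
  set (p := fun k i : nat => (m * Z.of_nat (q k) - 1 + Z.of_nat i)%Z).
  set (D := fun k => 2 * C0 * Rpower (INR (q k)) (- ((1 + mu) / 2 - mu * e / 2))).
  assert (HD : forall k, 0 < D k).
  { intros k. unfold D. pose proof (Rpower_pos (INR (q k)) (- ((1 + mu) / 2 - mu * e / 2))). nra. }
  set (U := fun k i z => (i < q k + 3)%nat /\ Z.gcd (p k i) (Z.of_nat (q k)) = 1%Z /\
    exists t, Rabs (2 * PI * t - IZR (p k i) / INR (q k)) <= Rpower (INR (q k)) (- mu) /\ phi t = z).
  assert (Hq1 : forall k, 1 <= INR (q k)) by (intros k; apply (le_INR 1); unfold q; lia).
  assert (HDp : forall k, rpow (D k) s = B * Rpower (INR (q k)) (- 2 - tau)).
  { intros k. rewrite rpow_pos_eq by apply HD. unfold D.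
    rewrite <- Rpower_mult_distr by (try apply Rpower_pos; lra). fold B.
    rewrite Rpower_mult. f_equal; f_equal. unfold tau; ring. }
  (* For [i >= q k + 3] the set is empty and costs 0. The factor 4 comes from [q + 3 <= 4 q]. *)
  apply (covered_double s E _ U (fun k i => if lt_dec i (q k + 3) then D k else 0)
    (fun k => 4 * B * Rpower (INR (q k)) (- 1 - tau))).
  - intros k i; destruct lt_dec; [left; apply HD|lra].
  - intros k i z z' (Hi & Hg & t & Ht & <-) (_ & _ & t' & Ht' & <-).
    destruct lt_dec as [_|Hn]; [|contradiction].
    assert (HPI := PI_RGT_0).
    set (t0 := IZR (p k i) / INR (q k) / (2 * PI)).
    assert (Ht0 : 2 * PI * t0 = IZR (p k i) / INR (q k)).
    { unfold t0. specialize (Hq1 k). field; lra. }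
    assert (Hrho : 0 < Rpower (INR (q k)) (- mu) <= / INR (q k) ^ 2).
    { split; [apply Rpower_pos|]. rewrite <- (Rpower_pow 2), <- Rpower_Ropp by (specialize (Hq1 k); lra).
      apply Rle_Rpower; [apply Hq1|]. simpl; lra. }
    assert (Hq0 : (0 < q k)%nat) by (unfold q; lia).
    pose proof (Hphi (p k i) (q k) t0 t _ Hq0 Hg Ht0 Ht Hrho) as B1.
    pose proof (Hphi (p k i) (q k) t0 t' _ Hq0 Hg Ht0 Ht' Hrho) as B2.
    replace (Cminus (phi t) (phi t')) with (Cplus (Cminus (phi t) (phi t0)) (Copp (Cminus (phi t') (phi t0)))).
    2: { unfold Cminus. ring. }
    eapply Rle_trans; [apply Cmod_triangle|]. rewrite Cmod_opp.
    assert (ED : C0 * Rpower (INR (q k)) (- (1 / 2)) * Rpower (Rpower (INR (q k)) (- mu)) ((1 - e) / 2)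
      = D k / 2).
    { unfold D. rewrite Rpower_mult, Rmult_assoc, <- Rpower_plus.
      replace (- (1 / 2) + - mu * ((1 - e) / 2)) with (- ((1 + mu) / 2 - mu * e / 2)) by field.
      field. }
    rewrite ED in B1, B2. lra.
  - intros z (t & (Hw & Hm) & Hz). destruct (Hw (S Q)) as (pp & qq & H1 & H2 & Hg & H3).
    set (k := (qq - S Q)%nat). assert (Eq : q k = qq) by (unfold q, k; lia).
    set (y := 2 * PI * t) in *.
    assert (Hqq : 1 <= INR qq) by (apply (le_INR 1); lia).
    assert (Hdist : Rabs (y * INR qq - IZR pp) <= 1).
    { replace (y * INR qq - IZR pp) with ((y - IZR pp / INR qq) * INR qq) by (field; lra).
      rewrite Rabs_mult, (Rabs_pos_eq (INR qq)) by lra.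
      apply Rle_trans with (Rpower (INR qq) (- (1)) * INR qq).
      - apply Rmult_le_compat_r; [lra|]. eapply Rle_trans; [apply H3|]. apply Rle_Rpower; lra.
      - rewrite Rpower_Ropp, Rpower_1 by lra. right; field; lra. }
    destruct (base_Int_part y) as [I1 I2]. rewrite Hm in I1, I2.
    apply Rabs_le_between in Hdist.
    assert (L1 : (m * Z.of_nat qq - 1 <= pp)%Z).
    { apply le_IZR. rewrite minus_IZR, mult_IZR, <- INR_IZR_INZ. nra. }
    assert (L2 : (pp <= m * Z.of_nat qq + Z.of_nat qq + 1)%Z).
    { apply le_IZR. rewrite !plus_IZR, mult_IZR, <- INR_IZR_INZ. nra. }
    set (i := Z.to_nat (pp - (m * Z.of_nat qq - 1))).
    assert (Ep : p k i = pp) by (unfold p, i; rewrite Eq; lia).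
    exists k, i. unfold U. rewrite Ep, Eq. split; [unfold i; lia|]. split; [exact Hg|].
    exists t; auto.
  - intros k n.
    rewrite (rsum_ext _ (fun i => if lt_dec i (q k + 3) then rpow (D k) s else 0)).
    2: { intros i _; destruct lt_dec; [reflexivity|now apply rpow_0_l]. }
    eapply Rle_trans; [apply rsum_cutoff, rpow_ge0|].
    rewrite HDp. specialize (Hq1 k). rewrite plus_INR.
    replace (- 1 - tau) with (1 + (- 2 - tau)) by ring.
    rewrite (Rpower_plus 1), Rpower_1 by lra.
    pose proof (Rpower_pos (INR (q k)) (- 2 - tau)). set (w := Rpower (INR (q k)) (- 2 - tau)) in *.
    assert (0 < B * w) by nra. simpl (INR 3). nra.
  - intros n. rewrite rsum_scal.
    apply Rle_trans with (4 * B * (E / (4 * B))).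
    + apply Rmult_le_compat_l; [lra|apply Htail].
    + right; field; lra.
Qed.

Lemma null_well_approximable (s mu : R) :
  0 < s -> 2 <= mu -> 4 / (1 + mu) < s -> null s (image phi (well_approximable mu)).
Proof.
  intros Hs Hmu Hsmu.
  apply null_incl with (fun z => exists i j : nat, image phi (fun t => well_approximable mu t
     /\ Int_part (2 * PI * t) = (Z.of_nat i - Z.of_nat j)%Z) z).
  - intros z (t & Ht & Hz). destruct (Z_diff_nat (Int_part (2 * PI * t))) as (i & j & Hij).
    exists i, j, t; auto.
  - apply null_union; intros i; apply null_union; intros j.
    now apply null_well_approximable_unit.
Qed.

(** For one [q] the distance of [y q] to the integers is positive; there are finitely many
    [q < Q]. *)
Lemma irrational_gap (t : R) (Q : nat) : ~ rational_point t ->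
  exists c, 0 < c <= 1 /\ forall (p : Z) (q : nat), (0 < q < Q)%nat ->
    c <= Rabs (2 * PI * t - IZR p / INR q).
Proof.
  intros Hirr. set (y := 2 * PI * t).
  assert (Hgap : forall q, (0 < q)%nat -> exists c, 0 < c /\ forall p : Z,
     c <= Rabs (y - IZR p / INR q)).
  { intros q Hq. assert (Hq0 : 0 < INR q) by (apply lt_0_INR; lia).
    set (b := Int_part (y * INR q)).
    destruct (base_Int_part (y * INR q)) as [B1 B2]. fold b in B1, B2.
    assert (B3 : IZR b <> y * INR q).
    { intros Eb; apply Hirr. exists b, q; split; [exact Hq|]. fold y. rewrite Eb. field; lra. }
    set (c := Rmin (y * INR q - IZR b) (IZR b + 1 - y * INR q)).
    assert (Hc : 0 < c) by (apply Rmin_pos; lra).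
    exists (c / INR q). split; [apply Rdiv_lt_0_compat; lra|]. intros p.
    replace (y - IZR p / INR q) with ((y * INR q - IZR p) / INR q) by (field; lra).
    unfold Rdiv. rewrite Rabs_mult, (Rabs_pos_eq (/ INR q))
      by (left; apply Rinv_0_lt_compat; lra).
    apply Rmult_le_compat_r; [left; apply Rinv_0_lt_compat; lra|].
    destruct (Z_le_gt_dec p b) as [Hp|Hp].
    - apply IZR_le in Hp. rewrite Rabs_pos_eq by lra.
      eapply Rle_trans; [apply Rmin_l|]. lra.
    - assert (Hp' : (b + 1 <= p)%Z) by lia. apply IZR_le in Hp'. rewrite plus_IZR in Hp'.
      rewrite Rabs_left1 by lra. eapply Rle_trans; [apply Rmin_r|]. lra. }
  induction Q as [|Q (c & Hc & IH)].
  - exists 1; split; [lra|]. intros; lia.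
  - destruct Q as [|Q].
    + exists 1; split; [lra|]. intros; lia.
    + destruct (Hgap (S Q) ltac:(lia)) as (c' & Hc' & H).
      exists (Rmin c c'). split.
      { split; [apply Rmin_pos; lra|]. eapply Rle_trans; [apply Rmin_l|lra]. }
      intros p q Hq. destruct (Nat.eq_dec q (S Q)) as [->|Hne].
      * eapply Rle_trans; [apply Rmin_r|apply H].
      * eapply Rle_trans; [apply Rmin_l|apply IH; lia].
Qed.

(** A Dirichlet scale [X > 1 / c], with [c] the gap to all fractions of denominator below [Q],
    forces [q >= Q]; and [q <= X] gives the error [1 / q^2]. *)
Lemma well_approximable_2 (t : R) : ~ rational_point t -> well_approximable 2 t.
Proof.
  intros Hirr Q. destruct (irrational_gap t Q Hirr) as (c & Hc & Hgap).
  assert (Hic : 1 <= / c) by (rewrite <- Rinv_1; apply Rinv_le_contravar; lra).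
  destruct (dirichlet (2 * PI * t) (/ c + 1) ltac:(lra)) as (p & qz & Hqz & Hg & HqX & Hapx).
  set (q := Z.to_nat qz).
  assert (Eq : Z.of_nat q = qz) by (unfold q; apply Z2Nat.id; lia).
  assert (EqR : IZR qz = INR q) by (rewrite INR_IZR_INZ, Eq; reflexivity).
  rewrite EqR in *. rewrite <- Eq in Hg.
  assert (Hq : (0 < q)%nat) by (unfold q; lia).
  assert (Hq1 : 1 <= INR q) by (apply (le_INR 1); lia).
  exists p, q. split; [|split; [exact Hq|split; [exact Hg|]]].
  - destruct (le_lt_dec Q q) as [H|H]; [exact H|exfalso].
    specialize (Hgap p q ltac:(lia)).
    assert (/ (INR q * (/ c + 1)) < c); [|lra].
    rewrite <- (Rinv_inv c) at 2. apply Rinv_lt_contravar; nra.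
  - rewrite Rpower_Ropp. replace 2 with (INR 2) by reflexivity. rewrite Rpower_pow by lra.
    eapply Rle_trans; [apply Hapx|]. apply Rinv_le_contravar; nra.
Qed.

(** The negation provides the constant 1 from some [Q] on; below [Q] the gap of an irrational point
    suffices, because [q^(-mu) <= 1]. *)
Lemma not_well_approximable (mu t : R) : 0 <= mu -> ~ rational_point t ->
  ~ well_approximable mu t ->
  exists c, 0 < c <= 1 /\ forall (p : Z) (q : nat), (0 < q)%nat ->
    Z.gcd p (Z.of_nat q) = 1%Z -> c * Rpower (INR q) (- mu) <= Rabs (2 * PI * t - IZR p / INR q).
Proof.
  intros Hmu Hirr Hw. apply not_all_ex_not in Hw. destruct Hw as [Q HQ].
  destruct (irrational_gap t Q Hirr) as (c & Hc & Hgap).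
  exists c; split; [exact Hc|]. intros p q Hq Hg.
  pose proof (Rpower_pos (INR q) (- mu)) as Hp.
  destruct (le_lt_dec Q q) as [H|H].
  - apply Rle_trans with (Rpower (INR q) (- mu)); [nra|].
    apply Rnot_lt_le; intros Hlt. apply HQ. exists p, q. repeat split; auto; lra.
  - apply Rle_trans with c; [|apply Hgap; lia].
    assert (Hq1 : 1 <= INR q) by (apply (le_INR 1); lia).
    assert (Rpower (INR q) (- mu) <= 1); [|nra].
    rewrite <- (Rpower_O (INR q)) by lra. apply Rle_Rpower; lra.
Qed.

(** * From Holder exponents to the dimension bound *)

Lemma D_below_approximable (alpha mu t : R) : 2 <= mu -> alpha < 1 / 2 + / (2 * mu) ->
  D_below alpha t -> ~ rational_point t -> well_approximable mu t.
Proof.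
  intros Hmu Ha (sigma & Hs0 & Hsa & Hsig) Hirr.
  (* Otherwise [phi] is Holder of some order [beta > alpha] at [t], against the exponent
     [sigma <= alpha]. *)
  apply NNPP; intros Hw.
  destruct (not_well_approximable mu t ltac:(lra) Hirr Hw) as (c & Hc & Hdio).
  (* The loss [e / 2] takes at most half of the gap, which keeps [beta] above [alpha]. *)
  set (e := Rmin (1 / 2) (1 / 2 + / (2 * mu) - alpha)).
  assert (He : 0 < e <= 1 / 2) by (split; [apply Rmin_pos; lra|apply Rmin_l]).
  assert (He2 : e <= 1 / 2 + / (2 * mu) - alpha) by apply Rmin_r.
  destruct (phi_diophantine t c mu e Hc Hmu He Hdio) as (C0 & HC0 & Hphi).
  set (beta := 1 / 2 + / (2 * mu) - e / 2) in *.
  assert (Hb : alpha < beta) by (unfold beta; lra).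
  pose proof PI_RGT_0 as HPI.
  assert (Hh : holder_at phi t beta).
  (* The constant polynomial [phi t] suffices; the other two witnesses rescale from [|2 PI h|] to
     [|h|]. *)
  { exists 0%nat, (fun _ => phi t), (C0 * Rpower (2 * PI) beta), (/ (2 * PI)).
    split; [simpl; lra|]. split.
    { apply Rmult_lt_0_compat; [exact HC0|apply Rpower_pos]. }
    split; [apply Rinv_0_lt_compat; lra|].
    intros h Hh. simpl cpoly.
    destruct (Req_dec h 0) as [->|H0].
    - rewrite Rplus_0_r. unfold Cminus; rewrite Cplus_opp_r, Cmod_0.
      apply Rmult_le_pos; [|apply rpow_ge0].
      apply Rmult_le_pos; [lra|left; apply Rpower_pos].
    - pose proof (Rabs_pos_lt h H0) as Hp.
      assert (Ev : Rabs (2 * PI * h) = 2 * PI * Rabs h)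
        by (rewrite Rabs_mult, (Rabs_pos_eq (2 * PI)); lra).
      eapply Rle_trans; [apply Hphi|].
      + rewrite Ev. split; [nra|].
        apply Rmult_lt_compat_l with (r := 2 * PI) in Hh; [|lra].
        rewrite Rinv_r in Hh by lra. lra.
      + rewrite Ev, rpow_pos_eq, <- Rpower_mult_distr by lra. lra. }
  unfold D_level, holder_exponent in Hsig.
  match type of Hsig with Lub_Rbar ?F = _ => destruct (Lub_Rbar_correct F) as [Hub _] end.
  assert (Hb0 : 0 <= beta) by lra.
  rewrite Hsig in Hub. specialize (Hub beta (conj Hb0 Hh)). simpl in Hub. lra.
Qed.

(** The two strict conditions say [4 / s - 1 < mu < 1 / (2 alpha - 1)], an interval that is nonempty
    precisely when [s > (4 alpha - 2) / alpha]; [alpha < 3/4] leaves room for [mu >= 2]. At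
    [alpha = 1/2] there is no upper constraint. *)
Lemma exponent_choice (alpha s : R) : 1 / 2 <= alpha < 3 / 4 -> (4 * alpha - 2) / alpha < s ->
  exists mu, 2 <= mu /\ 4 / (1 + mu) < s /\ alpha < 1 / 2 + / (2 * mu).
Proof.
  intros Ha Hs.
  assert (Hs2 : 4 * alpha - 2 < s * alpha).
  { apply Rmult_lt_compat_r with (r := alpha) in Hs; [|lra].
    unfold Rdiv in Hs; rewrite Rmult_assoc, Rinv_l in Hs; lra. }
  assert (Hs0 : 0 < s) by nra.
  enough (Hmu : exists mu, 2 <= mu /\ 4 < s * (1 + mu) /\ mu * (2 * alpha - 1) < 1).
  { destruct Hmu as (mu & H1 & H2 & H3). exists mu. split; [exact H1|]. split.
    - apply Rmult_lt_reg_r with (1 + mu); [lra|].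
      unfold Rdiv; rewrite Rmult_assoc, Rinv_l; lra.
    - apply Rmult_lt_reg_r with (2 * mu); [lra|].
      rewrite Rmult_plus_distr_r, Rinv_l by lra. lra. }
  assert (His : 0 < / s) by (apply Rinv_0_lt_compat; lra).
  assert (E4 : s * (4 * / s) = 4) by (field; lra).
  destruct (Req_dec alpha (1 / 2)) as [E|E].
  - exists (Rmax 2 (4 * / s)). pose proof (Rmax_l 2 (4 * / s)). pose proof (Rmax_r 2 (4 * / s)).
    split; [assumption|]. split; [nra|]. rewrite E. lra.
  - set (mu0 := / (2 * alpha - 1)).
    assert (Hmu0 : mu0 * (2 * alpha - 1) = 1) by (unfold mu0; field; lra).
    assert (Hmu2 : 2 < mu0).
    { apply Rmult_lt_reg_r with (2 * alpha - 1); lra. }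
    assert (Hlt : 4 * / s - 1 < mu0).
    { apply Rmult_lt_reg_l with (s * (2 * alpha - 1)); [nra|].
      replace (s * (2 * alpha - 1) * (4 * / s - 1))
        with ((s * (4 * / s)) * (2 * alpha - 1) - s * (2 * alpha - 1)) by ring.
      rewrite E4. replace (s * (2 * alpha - 1) * mu0) with (s * (mu0 * (2 * alpha - 1))) by ring.
      rewrite Hmu0. lra. }
    set (mu := Rmax 2 ((mu0 + (4 * / s - 1)) / 2)).
    assert (M1 : 2 <= mu) by apply Rmax_l.
    assert (M2 : (mu0 + (4 * / s - 1)) / 2 <= mu) by apply Rmax_r.
    assert (M3 : mu < mu0) by (apply Rmax_lub_lt; lra).
    exists mu. split; [exact M1|]. split; [|nra].
    assert (4 * / s - 1 < mu) by lra. nra.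
Qed.

Lemma image_D_below_null (alpha s : R) : 1 / 2 <= alpha <= 3 / 4 ->
  (4 * alpha - 2) / alpha < s -> null s (image phi (D_below alpha)).
Proof.
  intros Ha Hs.
  assert (Hs0 : 0 < s).
  { eapply Rle_lt_trans; [|exact Hs]. apply Rdiv_le_0_compat; lra. }
  assert (Hmu : exists mu, 2 <= mu /\ 4 / (1 + mu) < s /\
    forall t, D_below alpha t -> ~ rational_point t -> well_approximable mu t).
  { destruct (Rlt_le_dec alpha (3 / 4)) as [H|H].
    - destruct (exponent_choice alpha s) as (mu & H1 & H2 & H3); [lra|exact Hs|].
      exists mu. repeat split; auto. intros t; now apply D_below_approximable.
    (* At [alpha = 3/4] the strict inequality would force [mu < 2]. Dirichlet's theorem gives
       [mu = 2] itself, and [4 / (1 + 2)] is then exactly [(4 alpha - 2) / alpha]. *)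
    - exists 2. split; [lra|]. split; [|intros t _; apply well_approximable_2].
      replace alpha with (3 / 4) in Hs by lra. lra. }
  destruct Hmu as (mu & H1 & H2 & H3).
  apply null_incl with
    (fun z => image phi rational_point z \/ image phi (well_approximable mu) z).
  - intros z (t & Ht & Hz). destruct (classic (rational_point t)) as [Hr|Hr].
    + left; exists t; auto.
    + right; exists t; auto.
  - apply null_or; [now apply null_rational|now apply null_well_approximable].
Qed.

Theorem theorem1p2 : forall alpha : R, 1/2 <= alpha <= 3/4 ->
  Rbar_le (hausdorff_dim (image phi (D_level alpha)))
          (hausdorff_dim (image phi (D_below alpha))) /\
  Rbar_le (hausdorff_dim (image phi (D_below alpha)))
          (Finite ((4 * alpha - 2) / alpha)).
Proof.
  intros alpha Ha. split.
  - apply hausdorff_dim_incl. intros z (t & Ht & Hz). exists t; split; [|exact Hz].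
    exists alpha; repeat split; [lra|lra|exact Ht].
  - apply hausdorff_dim_le; [apply Rdiv_le_0_compat; lra|].
    intros s Hs. now apply image_D_below_null.
Qed.
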